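(* Let $\lambda=(\lambda_1,\lambda_2)$ be a partition with two parts, $\lambda_1\ge\lambda_2\ge1$. Then the average case complexity of the Novelli--Pak--Stoyanovskii algorithm on $\lambda$ is given by $$C(\lambda)=\frac{\lambda_1(\lambda_1-1)}{4}+\frac{\lambda_2(\lambda_2-3)}{4}-2\sum_{k=1}^{\lambda_2}\binom{\lambda_2}{k}\frac{(-1)^k(2k-2)!}{(\lambda_1-\lambda_2+2)_{2k-1}}.$$
   Context: $(x)_k$ denotes the Pochhammer symbol: $(x)_0=1$ and $(x)_k=x(x+1)\cdots(x+k-1)$ for positive integers $k$. A partition $\lambda$ of $n$ is identified with its Young diagram $\{(i,j):1\le i\le l(\lambda),\ 1\le j\le\lambda_i\}$ ($l(\lambda)$ is the number of parts), whose elements are called cells. A cell $(i,j)$ is a corner of $\lambda$ if neither $(i+1,j)$ nor $(i,j+1)$ belongs to $\lambda$. A tableau of shape $\lambda$ is a bijection $T:\lambda\to\{1,\dots,n\}$; the set of tableaux is $\mathrm{T}(\lambda)$. The (column-wise) Novelli--Pak--Stoyanovskii (NPS) algorithm applied to $T\in \mathrm{T}(\lambda)$: order cells by $(i,j)\preceq(i',j')$ if $j<j'$, or $j=j'$ and $i\le i'$. Let $(i_1,j_1)\succ\dots\succ(i_n,j_n)$ be the cells of $\lambda$ in decreasing order, put $k_r=T(i_r,j_r)$ (entries of the initial tableau) and $T_0=T$. For $r=1,\dots,n$ the tableau $T_r$ is obtained from $T_{r-1}$ as follows. Start with the current tableau equal to $T_{r-1}$ and repeat: let $(i,j)$ be the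 cell of the current tableau containing $k_r$. If $(i,j)$ is a corner of $\lambda$, stop. Otherwise let $m$ be the minimum of the entries of the current tableau in the cells of $\lambda\cap\{(i+1,j),(i,j+1)\}$. If $k_r<m$, stop. If $m<k_r$, exchange the entries $m$ and $k_r$ (one exchange) and repeat. When stopped, $T_r$ is the current tableau. $n(T)$ is the total number of exchanges performed during the construction of $T_1,\dots,T_n$, and $C(\lambda)=\frac1{n!}\sum_{T\in \mathrm{T}(\lambda)}n(T)$. *)

(* Defs.v *)
From HB Require Import structures.
From mathcomp Require Import all_boot all_order all_algebra all_fingroup.

Set Implicit Arguments.
Unset Strict Implicit.
Unset Printing Implicit Defensive.

Import GRing.Theory.
Local Open Scope nat_scope.

Definition poch (R : pzSemiRingType) (x : R) (k : nat) : R :=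
  (\prod_(i < k) (x + i%:R))%R.

(* Shapes are lists of parts [la], weakly decreasing and positive. Rows and
   columns are numbered from 0. Bounding the columns by the first part loses no
   cell because [la] is weakly decreasing. *)
Definition cell (la : seq nat) : finType :=
  {c : 'I_(size la) * 'I_(head 0 la) | c.2 < nth 0 la c.1}.

Section NPS.

Variable la : seq nat.

Definition crow (c : cell la) : nat := (val c).1.
Definition ccol (c : cell la) : nat := (val c).2.

Definition nbrs (c : cell la) : {set cell la} :=
  [set d | ((crow d == (crow c).+1) && (ccol d == ccol c))
        || ((crow d == crow c) && (ccol d == (ccol c).+1))].

Definition corner (c : cell la) : bool := nbrs c == set0.

(* The entries 1, ..., n are encoded as the elements 0, ..., n - 1 of ['I_n];
   the algorithm only compares entries. *)
Definition filling : finType := {ffun cell la -> 'I_(sumn la)}.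

Definition tableaux : {set filling} :=
  [set T : filling | injectiveb T & [forall k, exists c, T c == k]].

Definition cell_le (c d : cell la) : bool :=
  (ccol c < ccol d) || ((ccol c == ccol d) && (crow c <= crow d)).

Definition nps_order : seq (cell la) := rev (sort cell_le (enum (cell la))).

(* The cell holding the minimum m of the entries next to the entry of c, when
   c is not a corner and m is smaller than that entry. *)
Definition exchange_cell (T : filling) (c : cell la) : option (cell la) :=
  if corner c then None
  else [pick d in nbrs c | [forall e in nbrs c, T d <= T e] & T d < T c].

Definition exchange (T : filling) (c d : cell la) : filling :=
  [ffun e => T (tperm c d e)].

Definition nps_step (k : 'I_(sumn la)) (T : filling) : option filling :=
  if [pick c | T c == k] is Some c then
    omap (exchange T c) (exchange_cell T c)
  else None.

(* The second component of [s] counts exchanges. *)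
Fixpoint slide (fuel : nat) (k : 'I_(sumn la)) (s : filling * nat) :=
  if fuel is fuel'.+1 then
    if nps_step k s.1 is Some T' then slide fuel' k (T', s.2.+1) else s
  else s.

(* Enough for every slide to run until it stops, see [slide_stops]. *)
Definition slide_fuel : nat := size la + head 0 la.

Definition nps (T : filling) : filling * nat :=
  foldl (fun s c => slide slide_fuel (T c) s) (T, 0) nps_order.

Definition nexchanges (T : filling) : nat := (nps T).2.

Definition nps_complexity : rat :=
  ((\sum_(T in tableaux) (nexchanges T)%:R) / ((sumn la)`!)%:R)%R.

Lemma slide_stops (k : 'I_(sumn la)) (s : filling * nat) :
  injective s.1 -> nps_step k (slide slide_fuel k s).1 = None.
Proof.
move=> injT; case E: [pick c | s.1 c == k] => [c|]; last first.
  have stop : nps_step k s.1 = None by rewrite /nps_step E.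
  by case: slide_fuel => [|f] //=; rewrite stop.
have Tc : s.1 c = k by move: E; case: pickP => // x /eqP xk [<-].
have : slide_fuel <= crow c + ccol c + slide_fuel by apply: leq_addl.
move: {2 3}slide_fuel => f; elim: f s c injT Tc {E} => [|f IH] s c injT Tc.
  rewrite addn0 leqNgt /slide_fuel => /negP[].
  by rewrite -addSn leq_add ?ltn_ord // ltnW ?ltn_ord.
move=> le_f /=; case E: (nps_step k s.1) => [T'|] //.
move: E; rewrite /nps_step; case: pickP => // c' /eqP Tc'.
have {c' Tc'}-> : c' = c by apply: injT; rewrite Tc Tc'.
rewrite /exchange_cell; case: ifP => // _; case: pickP => //= d /andP[dc _] [<-].
apply: (IH _ d) => /=.
- by move=> x y; rewrite !ffunE => /injT/perm_inj.
- by rewrite ffunE tpermR.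
- apply: leq_trans le_f _; rewrite addnS -addSn leq_add2r.
  move: dc; rewrite inE => /orP[]/andP[/eqP-> /eqP->]; first by rewrite addSn.
  by rewrite addnS.
Qed.

End NPS.

(* Main.v *)
From HB Require Import structures.
Require Import Defs.
From mathcomp Require Import all_boot all_order all_algebra.
From mathcomp Require Import perm zify ring.

Set Implicit Arguments.
Unset Strict Implicit.
Unset Printing Implicit Defensive.

Import GRing.Theory Num.Theory.

(* Only the relative order of the entries matters, so a tableau may be replaced
   by the sequence of ranks of its entries at the time they are processed, which
   runs over all sequences with r-th term at most r. The processed entries, read
   in increasing order with their rows recorded, form a lattice path, and adding
   one column of two cells is an operation on paths. Every ballot path R arises
   equally often from this operation, and the exchanges it costs, summed over
   the preimages of R, have a closed form in which R enters only through the
   statistic [quad]. Summing over ballot paths by reflection gives partial sums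
   of binomial coefficients; so does expanding the integral of
   (1 - x)^(m + p + 1) (1 + x)^p over [0, 1], which is also the alternating sum
   in the increment of the stated formula. *)

(* Words encode the relative order of the entries processed so far: reading
   these entries in increasing order, write [true] for an entry of row 1 and
   [false] for an entry of row 2. A word is then read as a lattice path with up
   steps [true] and down steps [false]. *)

(** Columns are processed from right to left, so the induction adds a column on the left: [l2] grows
    while m = l1 - l2 stays fixed. The word determines the effect and the cost of every later
    insertion but forgets the exchanges already made; the costs can still be added column by column
    because all ballot paths have equally many rank sequences above them. That common number is the
    product of the hook lengths of the shape. To sum over the preimages of a path R, the insertions
    are undone while R is read from the left, which forces statements for an arbitrary starting
    height h and a number d of down steps already read. The statistic [quad] counts the pairs of
    down steps of a ballot path between which the path visits height 0. For a path from height 0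
    with b down steps, b^2 - 2 quad is therefore the sum of the squares of the numbers of down steps
    in the stretches between successive visits to 0. *)

Definition downs (R : seq bool) : nat := count negb R.

Fixpoint ballot (h : nat) (R : seq bool) : bool :=
  match R with
  | [::] => true
  | true :: R' => ballot h.+1 R'
  | false :: R' => if h is h'.+1 then ballot h' R' else false
  end.

(** This is the cost of an insertion in row 2: the new entry is exchanged with each smaller entry of
    that row. *)
Fixpoint downs_before (P : seq bool) (s : nat) : nat :=
  match P, s with
  | x :: P', s'.+1 => ~~ x + downs_before P' s'
  | _, _ => 0
  end.

Fixpoint insert_down (P : seq bool) (s : nat) : seq bool :=
  match P, s with
  | x :: P', s'.+1 => x :: insert_down P' s'
  | _, _ => false :: P
  end.

(* The slide of an entry of rank [t] inserted in row 1; [h] counts the entries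
   of row 2 that the sliding cell has passed and that are still to be read. *)
Fixpoint slide_word (h : nat) (Q : seq bool) (t : nat) : seq bool :=
  match Q, t with
  | true :: R, t'.+1 => true :: slide_word h.+1 R t'
  | false :: R, t'.+1 =>
      if h is h'.+1 then false :: slide_word h' R t'
      else true :: insert_down R t'
  | _, _ => true :: Q
  end.

Fixpoint slide_cost (h : nat) (Q : seq bool) (t : nat) : nat :=
  match Q, t with
  | true :: R, t'.+1 => (slide_cost h.+1 R t').+1
  | false :: R, t'.+1 =>
      if h is h'.+1 then slide_cost h' R t' else (downs_before R t').+1
  | _, _ => 0
  end.

(* The number of down steps until the path started at height [h] first reaches
   height [-1] (all of them if it never does). *)
Fixpoint hit (h : nat) (Q : seq bool) : nat :=
  match Q with
  | [::] => 0
  | true :: R => hit h.+1 R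
  | false :: R => (if h is h'.+1 then hit h' R else 0).+1
  end.

(** The same count for the first visit to height 0. *)
Definition hitp (h : nat) (Q : seq bool) : nat :=
  if h is h'.+1 then hit h' Q else 0.

Lemma hit_downs h Q : hit h Q <= downs Q.
Proof.
rewrite /downs; elim: Q h => [|[] R IH] h //=; rewrite ltnS.
by case: h => [|h] //; apply: IH.
Qed.

Lemma hitp_downs h Q : hitp h Q <= downs Q.
Proof. by case: h => // h; apply: hit_downs. Qed.

(** * Sums over ballot paths and over the preimages of an insertion *)

Section BallotSums.

Variable V : nmodType.
Implicit Types (F : seq bool -> V).
Local Open Scope ring_scope.

Fixpoint ballot_sum (n b h : nat) F : V :=
  if n is n'.+1 then
    ballot_sum n' b h.+1 (fun R => F (true :: R)) +
    (if b is b'.+1 then if h is h'.+1 then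
       ballot_sum n' b' h' (fun R => F (false :: R)) else 0 else 0)
  else if b == 0%N then F [::] else 0.

Lemma ballot_sumS n b h F :
  ballot_sum n.+1 b h F =
  ballot_sum n b h.+1 (fun R => F (true :: R)) +
  (if b is b'.+1 then if h is h'.+1 then
     ballot_sum n b' h' (fun R => F (false :: R)) else 0 else 0).
Proof. by []. Qed.

Lemma eq_ballot_sum n b h F F' :
    (forall R, size R = n -> downs R = b -> ballot h R -> F R = F' R) ->
  ballot_sum n b h F = ballot_sum n b h F'.
Proof.
elim: n b h F F' => [|n IH] b h F F' eqF /=.
  by case: eqP => // b0; apply: eqF.
congr (_ + _).
  by apply: IH => R sR dR bR; apply: eqF => //=; rewrite sR.
case: b eqF => [|b] eqF //; case: h eqF => [|h] eqF //.
apply: IH => R sR dR bR; apply: eqF => //=; first by rewrite sR.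
by move: dR; rewrite /downs /= => ->.
Qed.

Lemma ballot_sum0 n b h : ballot_sum n b h (fun=> 0) = 0.
Proof.
elim: n b h => [|n IH] b h /=; first by case: ifP.
by rewrite IH add0r; case: b => // b; case: h.
Qed.

Lemma ballot_sumD n b h F F' :
  ballot_sum n b h (fun R => F R + F' R) =
  ballot_sum n b h F + ballot_sum n b h F'.
Proof.
elim: n b h F F' => [|n IH] b h F F' /=; first by case: ifP; rewrite ?addr0.
rewrite IH addrACA; congr (_ + _).
by case: b => [|b]; case: h => [|h]; rewrite ?addr0 ?IH.
Qed.

Lemma ballot_sum_eq0 n b h F :
    (forall R, downs R = b -> F R = 0) -> ballot_sum n b h F = 0.
Proof.
by move=> F0; rewrite -(ballot_sum0 n b h); apply: eq_ballot_sum => R _ /F0.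
Qed.

(** To undo an insertion, delete down step number i of Q, which lifts the rest of the path by one.
    The result is ballot from h exactly when the deleted step comes no later than the first arrival
    of Q, read from h, at height -1; this is i < [hit h Q]. *)
Lemma ballot_sum_insert_down n b h (G : nat -> seq bool -> V) :
  ballot_sum n b h
    (fun P => \sum_(s < n.+1) G (downs_before P s) (insert_down P s)) =
  ballot_sum n.+1 b.+1 h.+1 (fun Q => \sum_(i < hit h Q) G i Q).
Proof.
elim: n b h G => [|n IH] b h G.
  rewrite /= add0r; case: b => [|b] //=.
  by case: h => [|h]; rewrite /= !big_ord_recl !big_ord0.
rewrite [RHS]/= -/(ballot_sum n.+1 b.+1 h.+2 (fun R => \sum_(i < hit h.+1 R) G i (true :: R))).
rewrite -/(ballot_sum n.+1 b h (fun R => \sum_(i < (hitp h R).+1) G i (false :: R))).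
(* The term i = 0 of a path beginning with a down step is the insertion at the front. *)
have -> : ballot_sum n.+1 b h (fun R => \sum_(i < (hitp h R).+1) G i (false :: R)) =
  ballot_sum n.+1 b h (fun R => G 0%N (false :: R)) +
  ballot_sum n.+1 b h (fun R => \sum_(i < hitp h R) G i.+1 (false :: R)).
  rewrite -ballot_sumD; apply: eq_ballot_sum => R _ _ _.
  by rewrite big_ord_recl.
rewrite (eq_ballot_sum (F' := fun P => G 0%N (false :: P) +
    \sum_(s < n.+1) G (downs_before P s.+1) (insert_down P s.+1))); last first.
  by move=> P _ _ _; rewrite big_ord_recl; case: P.
rewrite ballot_sumD addrCA; congr (_ + _).
rewrite [LHS]/= (IH b h.+1 (fun i Q => G i (true :: Q))); congr (_ + _).
case: b => [|b].
  symmetry; apply: ballot_sum_eq0 => R dR.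
  by move: (hitp_downs h R); rewrite dR leqn0 => /eqP->; rewrite big_ord0.
case: h => [|h]; last exact: (IH b h (fun i Q => G i.+1 (false :: Q))).
by symmetry; apply: ballot_sum_eq0 => R _; rewrite big_ord0.
Qed.

(* [G w f] is summed over the pairs (Q, t) with [slide_word h Q t = R], where
   w is [hit h Q] and f the cost of the slide. *)
Fixpoint slide_sum (h : nat) (R : seq bool) (G : nat -> nat -> V) : V :=
  match R with
  | [::] => 0
  | true :: R' =>
      G (hit h R') 0%N + slide_sum h.+1 R' (fun w f => G w f.+1) +
      (if h is 0%N then \sum_(i < hit 0 R') G 1%N i.+1 else 0)
  | false :: R' =>
      if h is h'.+1 then slide_sum h' R' (fun w f => G w.+1 f) else 0
  end.

(** A leading up step of R is the inserted entry, or an entry of row 1 that it passed, or, at height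
    0 only, an entry of row 2 that moved up. In the last case Q begins with a down step to height
    -1, so w = 1, and the rest of R comes from an insertion in row 2. *)
Lemma ballot_sum_slide n b h (G : nat -> nat -> seq bool -> V) :
  ballot_sum n b h.+1
    (fun Q => \sum_(t < n.+1) G (hit h Q) (slide_cost h Q t) (slide_word h Q t)) =
  ballot_sum n.+1 b h (fun R => slide_sum h R (fun w f => G w f R)).
Proof.
elim: n b h G => [|n IH] b h G.
  rewrite /=; case: b => [|b] /=; last first.
    by rewrite add0r; case: h => // h; rewrite if_same.
  rewrite big_ord_recl big_ord0 /= !addr0.
  by case: h => [|h]; rewrite ?big_ord0 !addr0.
rewrite [RHS]ballot_sumS.
rewrite -[X in _ = X + _]/(ballot_sum n.+1 b h.+1 (fun R =>
  G (hit h R) 0%N (true :: R) +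
  slide_sum h.+1 R (fun w f => G w f.+1 (true :: R)) +
  (if h is 0%N then \sum_(i < hit 0 R) G 1%N i.+1 (true :: R) else 0))).
rewrite !ballot_sumD.
rewrite (eq_ballot_sum (F' := fun Q => G (hit h Q) 0%N (true :: Q) +
    \sum_(t < n.+1) G (hit h Q) (slide_cost h Q t.+1) (slide_word h Q t.+1))); last first.
  by move=> Q _ _ _; rewrite big_ord_recl; case: Q => [|[] Q].
rewrite ballot_sumD -[RHS]addrA -[RHS]addrA; congr (_ + _).
rewrite [LHS]ballot_sumS (IH b h.+1 (fun w f R => G w f.+1 (true :: R))); congr (_ + _).
case: h => [|h]; last first.
  rewrite ballot_sum0 add0r; case: b => // b.
  exact: (IH b h (fun w f R => G w.+1 f (false :: R))).
have -> : (if b is b'.+1 then 0 else 0) = 0 :> V by case: b.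
rewrite addr0; case: b => [|b].
  symmetry; apply: ballot_sum_eq0 => R dR.
  by move: (hit_downs 0 R); rewrite dR leqn0 => /eqP->; rewrite big_ord0.
exact: (ballot_sum_insert_down n b 0 (fun i R => G 1%N i.+1 (true :: R))).
Qed.

Lemma eq_slide_sum h R G G' : (forall w f, G w f = G' w f) ->
  slide_sum h R G = slide_sum h R G'.
Proof.
elim: R h G G' => [|[] R IH] h G G' eqG //=.
  rewrite eqG; congr (_ + _ + _); first by apply: IH => w f; apply: eqG.
  by case: h => // ; apply: eq_bigr => i _; apply: eqG.
by case: h => // h; apply: IH => w f; apply: eqG.
Qed.

End BallotSums.

(** * Closed forms for one column, and their sums over ballot paths *)

Section ClosedForms.

Local Open Scope ring_scope.

(* [quad] and [cost_form] come from solving the recursion of [slide_sum]; in the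
   lemmas below [d] counts the down steps read before the rest [R] of the path. *)
Fixpoint quad (h : nat) (R : seq bool) : rat :=
  match R with
  | [::] => 0
  | true :: R' => quad h.+1 R'
  | false :: R' =>
      if h is h'.+1 then quad h' R' + (downs R')%:R - (hitp h' R')%:R else 0
  end.

(** For a path from height 0, d + h up steps have been read, so the first product is b(a + 1) for
    the whole path with a up and b down steps; the second is the share of the steps already read. It
    vanishes for d = h = 0, which leaves a weight common to all paths with these numbers of
    steps. *)
Lemma slide_sum_weight h R d : ballot h R ->
  slide_sum h R (fun w f => (w + d)%:R : rat) =
  ((downs R)%:R + d%:R) * ((size R)%:R - (downs R)%:R + h%:R + d%:R + 1)
  - (d%:R + (hitp h R)%:R) * (d%:R + h%:R + 1).
Proof.
elim: R h d => [|[] R IH] h d /=; first by case: h => *; rewrite /downs /=; ring.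
  move=> bR; rewrite IH // /downs /= -/(downs R) add0n.
  case: h bR => [|h] bR /=; last by ring.
  by rewrite sumr_const card_ord -mulr_natl; ring.
case: h => // h bR; rewrite (eq_slide_sum _ R (G' := fun w f => (w + d.+1)%:R)); last first.
  by move=> w _; rewrite addnS.
rewrite IH // /downs /= -/(downs R).
rewrite -/(hitp h R).
by ring.
Qed.

Definition cost_form (d a b q : rat) : rat :=
  (b + d) * ((a + d) * (a + b + 2 * d - 2) + 3 * (b + d) + 1)
  - 2 * (b ^+ 2 - 2 * q) - 2 * d ^+ 3 - d ^+ 2 - d.

Lemma sum_affine (x : nat) (u v : rat) :
  \sum_(i < x) (u + v * i%:R) = u * x%:R + v * (x%:R * (x%:R - 1)) / 2.
Proof.
elim: x => [|x IH]; first by rewrite big_ord0; field.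
by rewrite big_ord_recr /= IH; field.
Qed.

(** With w' = w + d and f' = f + d + h the summand is twice the sum of i + f' over i < w': each of
    the d + h up steps passed so far cost one exchange. If R reaches height 0, it has x down steps
    up to that point, and the last three arguments of [cost_form] are the up steps, the down steps
    and [quad] of the path beyond it. *)
Lemma slide_sum_cost h R d : ballot h R ->
  slide_sum h R
    (fun w f => 2 * (w%:R + d%:R) * (f%:R + d%:R + h%:R)
                + (w%:R + d%:R) * (w%:R + d%:R - 1) : rat) =
  let x := (hitp h R)%:R in
  let e := d%:R + x in
  let a := (size R)%:R - (downs R)%:R in
  let b := (downs R)%:R in
  e * (x - h%:R) * (2 * d%:R + h%:R + x - 1) + (x - h%:R) * e * (e - 1)
  + cost_form e (a - x + h%:R) (b - x) (quad h R - x * (b - x)).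
Proof.
rewrite /cost_form; elim: R h d => [|[] R IH] h d /=.
- by case: h => *; rewrite /downs /=; ring.
- move=> bR; rewrite (eq_slide_sum _ R (G' := fun w f =>
    2 * (w%:R + d%:R) * (f%:R + d%:R + h.+1%:R)
    + (w%:R + d%:R) * (w%:R + d%:R - 1))); last by move=> w f; ring.
  rewrite IH // /downs /= -/(downs R) add0n.
  case: h bR => [|h] bR /=; last by ring.
  rewrite (eq_bigr (fun i : 'I_ _ => 2 * (1 + d%:R) * (1 + d%:R) + (1 + d%:R) * d%:R
     + 2 * (1 + d%:R) * i%:R)); last by move=> i _; ring.
  by rewrite sum_affine; field.
case: h => // h bR; rewrite (eq_slide_sum _ R (G' := fun w f =>
    2 * (w%:R + d.+1%:R) * (f%:R + d.+1%:R + h%:R)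
    + (w%:R + d.+1%:R) * (w%:R + d.+1%:R - 1))); last by move=> w f; ring.
rewrite IH // /downs /= -/(downs R).
rewrite -/(hitp h R).
by ring.
Qed.

(** The test avoids truncated subtraction, which would give 1 instead of 0 for j > b. *)
Definition binz (n b j : nat) : nat := if (j <= b)%N then 'C(n, b - j) else 0.

Definition binz_sum (n b j : nat) : nat := \sum_(i < b.+1 - j) 'C(n, i).

Lemma binzSS n b j : binz n b.+1 j.+1 = binz n b j.
Proof. by rewrite /binz ltnS subSS. Qed.

Lemma binz_pascal n b j : binz n.+1 b.+1 j = (binz n b.+1 j + binz n b j)%N.
Proof.
rewrite /binz; case: (ltngtP j b.+1) => [jb|jb|->].
- by rewrite -ltnS jb subSn // binS.
- by rewrite leqNgt ltnW.
- by rewrite ltnn subnn !bin0.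
Qed.

Lemma binz_sumSS n b j : binz_sum n b.+1 j.+1 = binz_sum n b j.
Proof. by rewrite /binz_sum subSS. Qed.

Lemma binz_sumE n b j : binz_sum n b j = (binz n b j + binz_sum n b j.+1)%N.
Proof.
rewrite /binz_sum /binz subSS; case: leqP => jb.
  by rewrite subSn // big_ord_recr /= addnC.
have [-> ->] : (b.+1 - j = 0)%N /\ (b - j = 0)%N by lia.
by rewrite !big_ord0.
Qed.

Lemma binz_sum_pascal n b j :
  binz_sum n.+1 b j = (binz_sum n b j + binz_sum n b j.+1)%N.
Proof.
rewrite /binz_sum subSS; case: (leqP j b) => jb; last first.
  have [-> ->] : (b.+1 - j = 0)%N /\ (b - j = 0)%N by lia.
  by rewrite !big_ord0.
rewrite subSn //; move: (b - j)%N => k.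
rewrite !big_ord_recl /= !bin0 -addnA; congr (_ + _)%N.
by rewrite -big_split; apply: eq_bigr => i _; rewrite binS.
Qed.

Lemma binz_small n b j : (b < j)%N -> binz n b j = 0%N.
Proof. by move=> bj; rewrite /binz leqNgt bj. Qed.

Lemma binz_sum_small n b j : (b < j)%N -> binz_sum n b j = 0%N.
Proof.
move=> bj; rewrite /binz_sum; have -> : (b.+1 - j = 0)%N by lia.
by rewrite big_ord0.
Qed.

(** Reflection principle: the second term counts the paths that reach -1. The hypothesis says that
    the end height is at least -1. *)
Lemma ballot_sum1 n b h : (2 * b <= n + h + 1)%N ->
  ballot_sum n b h (fun=> 1) = (binz n b 0)%:R - (binz n b h.+1)%:R :> rat.
Proof.
elim: n b h => [|n IH] b h le_b.
  rewrite /= (@binz_small _ _ h.+1) ?subr0; last by lia.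
  by rewrite /binz subn0 bin0n; case: eqP.
rewrite ballot_sumS IH; last by lia.
case: b le_b => [|b] le_b; first by rewrite ![binz _ 0 _.+1]binz_small // /binz !bin0; ring.
case: h le_b => [|h] le_b; last first.
  by rewrite IH ?binz_pascal ?binzSS; [ring|lia].
by rewrite !binz_pascal !binzSS; ring.
Qed.

Lemma ballot_sum_const n b h (c : rat) :
  ballot_sum n b h (fun=> c) = c * ballot_sum n b h (fun=> 1).
Proof.
elim: n b h => [|n IH] b h /=; first by case: eqP; rewrite ?mulr1 ?mulr0.
rewrite IH mulrDr; congr (_ + _).
by case: b => [|b]; case: h => [|h]; rewrite ?mulr0 ?IH.
Qed.

(** The summand is what a down step to height h adds to [quad]. The first factor on the right is the
    end height plus one, which is invariant under the recursion. *)
Lemma ballot_sum_downs_hitp n b h : (2 * b <= n + h + 1)%N ->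
  ballot_sum n b h (fun R => (downs R)%:R - (hitp h R)%:R) =
  (n%:R - 2 * b%:R + h%:R + 1) * (binz n b h.+1)%:R :> rat.
Proof.
elim: n b h => [|n IH] b h le_b.
  rewrite /= (@binz_small _ _ h.+1) ?mulr0; last by lia.
  by case: h le_b => [|h] _; rewrite /= subrr if_same.
case: h le_b => [|h] le_b.
  rewrite (eq_ballot_sum (F' := fun=> b%:R)); last by move=> R _ -> _; rewrite /= subr0.
  rewrite ballot_sum_const ballot_sum1 //.
  case: b le_b => [|b] le_b; first by rewrite ![binz _ 0 _.+1]binz_small //; ring.
  rewrite binzSS /binz !subn0 /=.
  have := congr1 (fun k => k%:R : rat) (mul_bin_left n.+1 b).
  rewrite !natrM natrB; last by lia.
  move=> E; rewrite mulrBr E; ring.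
rewrite ballot_sumS.
rewrite (eq_ballot_sum (F' := fun R => (downs R)%:R - (hitp h.+2 R)%:R)); last by [].
rewrite IH; last by lia.
case: b le_b => [|b] le_b; first by rewrite !binz_small //; ring.
rewrite (eq_ballot_sum (F' := fun R => (downs R)%:R - (hitp h R)%:R)); last first.
  move=> R _ _ _; rewrite /downs /= -/(downs R).
  rewrite -/(hitp h R).
  by ring.
rewrite IH; last by lia.
by rewrite binz_pascal !binzSS; ring.
Qed.

(** The end height plus one factors out again; the single binomial coefficients added at the down
    steps accumulate to partial sums. *)
Lemma ballot_sum_quad n b h : (2 * b <= n + h + 1)%N ->
  ballot_sum n b h (quad h) =
  (n%:R - 2 * b%:R + h%:R + 1) *
  (h%:R * (binz_sum n b h.+1)%:R + (binz_sum n b h.+2)%:R).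
Proof.
elim: n b h => [|n IH] b h le_b.
  by rewrite /= !binz_sum_small ?if_same ?mulr0 ?addr0 ?mulr0 //; lia.
rewrite ballot_sumS.
rewrite (eq_ballot_sum (F' := quad h.+1)); last by [].
rewrite IH; last by lia.
case: b le_b => [|b] le_b; first by rewrite !binz_sum_small //; ring.
case: h le_b => [|h] le_b.
  by rewrite !binz_sum_pascal !binz_sumSS; ring.
rewrite (eq_ballot_sum (F' := fun R => quad h R + ((downs R)%:R - (hitp h R)%:R))); last first.
  by move=> R _ _ _ /=; rewrite addrA.
rewrite ballot_sumD IH ?ballot_sum_downs_hitp; try lia.
rewrite !binz_sum_pascal !binz_sumSS (binz_sumE n b h.+1).
by ring.
Qed.

End ClosedForms.

(** * Integrals of polynomials over the unit interval *)

Section BetaIntegrals.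

Local Open Scope ring_scope.

(* The integral of [q] over [0, 1]. *)
Definition unit_integral (q : {poly rat}) : rat :=
  \sum_(i < size q) q`_i / i.+1%:R.

Lemma unit_integral_widen n (q : {poly rat}) : (size q <= n)%N ->
  unit_integral q = \sum_(i < n) q`_i / i.+1%:R.
Proof.
move=> le_n; rewrite /unit_integral (big_ord_widen _ (fun i => q`_i / i.+1%:R) le_n).
rewrite big_mkcond; apply: eq_bigr => i _; case: ltnP => // le_i.
by rewrite nth_default ?mul0r.
Qed.

Fact unit_integral_is_linear : scalar unit_integral.
Proof.
move=> c p q; set n := maxn (size p) (size q).
rewrite !(@unit_integral_widen n) ?leq_maxl ?leq_maxr //; last first.
  apply: leq_trans (size_polyD _ _) _; rewrite geq_max leq_maxr andbT.
  by apply: leq_trans (size_scale_leq _ _) (leq_maxl _ _).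
rewrite mulr_sumr -big_split; apply: eq_bigr => i _.
by rewrite coefD coefZ mulrDl mulrA.
Qed.

HB.instance Definition _ :=
  GRing.isLinear.Build rat {poly rat} rat *%R unit_integral unit_integral_is_linear.

Lemma unit_integral_deriv q : unit_integral q^`() = q.[1] - q.[0].
Proof.
rewrite (@unit_integral_widen (size q)); last first.
  by rewrite (leq_trans (size_poly _ _)) ?leq_pred.
rewrite horner_coef0 (@horner_coef_wide _ (size q).+1) //.
rewrite big_ord_recl expr0 mulr1 addrAC subrr add0r; apply: eq_bigr => i _.
by rewrite coef_deriv expr1n mulr1 lift0 -(mulr_natr q`_i.+1) mulfK // pnatr_eq0.
Qed.

(** Integration by parts; the 1 is the boundary term at 0. *)
Lemma unit_integral_pow_rec a b :
  unit_integral ((1 - 'X) ^+ a * (1 + 'X) ^+ b.+1) * a.+1%:R =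
  1 + unit_integral ((1 - 'X) ^+ a.+1 * (1 + 'X) ^+ b) * b.+1%:R.
Proof.
have := unit_integral_deriv ((1 - 'X) ^+ a.+1 * (1 + 'X) ^+ b.+1).
rewrite !hornerE ?subrr ?expr0n ?expr1n /= mul0r mulr1 sub0r.
have -> : ((1 - 'X) ^+ a.+1 * (1 + 'X) ^+ b.+1)^`() =
    ((1 - 'X) ^+ a.+1 * (1 + 'X) ^+ b) *+ b.+1
    - ((1 - 'X) ^+ a * (1 + 'X) ^+ b.+1) *+ a.+1 :> {poly rat}.
  by rewrite derivM !deriv_exp derivB derivD !derivC !derivX /=; ring.
rewrite linearB !linearMn /= -!(mulr_natr (unit_integral _)) => E.
by move/eqP: E; rewrite subr_eq => /eqP ->; ring.
Qed.

Lemma unit_integral_pow0 a : unit_integral ((1 - 'X) ^+ a) = a.+1%:R^-1.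
Proof.
have a0 : (a.+1%:R : rat) != 0 by rewrite pnatr_eq0.
have := unit_integral_deriv ((1 - 'X) ^+ a.+1).
rewrite !hornerE ?subrr ?expr0n ?expr1n /= sub0r.
have -> : ((1 - 'X) ^+ a.+1)^`() = - ((1 - 'X) ^+ a *+ a.+1) :> {poly rat}.
  by rewrite deriv_exp derivB !derivC !derivX /=; ring.
rewrite linearN linearMn /= => /oppr_inj; rewrite -(mulr_natr (unit_integral _)) => E.
by apply: (mulIf a0); rewrite E mulVf.
Qed.

Lemma natf_fact_neq0 n : (n`!%:R : rat) != 0.
Proof. by rewrite pnatr_eq0 -lt0n fact_gt0. Qed.

(** Each integration by parts lowers b by one, and its boundary term supplies the last binomial
    coefficient of the partial sum. *)
Lemma unit_integral_pow a b :
  unit_integral ((1 - 'X) ^+ a * (1 + 'X) ^+ b) =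
  b`!%:R * a`!%:R / (a + b).+1`!%:R * (binz_sum (a + b).+1 b 0)%:R.
Proof.
elim: b a => [|b IH] a; have a0 : (a.+1%:R : rat) != 0 by rewrite pnatr_eq0.
  rewrite mulr1 unit_integral_pow0 addn0 /binz_sum big_ord_recl big_ord0 bin0.
  rewrite addn0 mulr1 fact0 mul1r.
  by rewrite factS natrM; field; rewrite nat1r a0 natf_fact_neq0.
apply: (mulIf a0); rewrite unit_integral_pow_rec IH addSnnS.
have -> : binz_sum (a + b.+1).+1 b.+1 0 =
    (binz_sum (a + b.+1).+1 b 0 + 'C((a + b.+1).+1, b.+1))%N.
  by rewrite /binz_sum !subn0 big_ord_recr.
have E : 'C((a + b.+1).+1, b.+1)%:R * (b.+1`!%:R * a.+1`!%:R) = (a + b.+1).+1`!%:R :> rat.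
  have le_b : (b.+1 <= (a + b.+1).+1)%N by lia.
  rewrite -!natrM -(bin_fact le_b); congr ((_ * (_ * _`!))%N%:R).
  by lia.
have N0 := natf_fact_neq0 (a + b.+1).+1.
rewrite natrD mulrDr mulrDl addrC {IH}.
set N : rat := (a + b.+1).+1`!%:R in E N0 *; clearbody N; congr (_ + _).
  by rewrite [b.+1`!]factS [a.+1`!]factS !natrM; field.
apply: (mulIf N0).
rewrite mul1r -[LHS]E [a.+1`!]factS natrM.
by field.
Qed.

Lemma unit_integral_beta j c :
  unit_integral ('X^j * (1 - 'X) ^+ c) = j`!%:R * c`!%:R / (j + c).+1`!%:R.
Proof.
elim: j c => [|j IH] c; have c0 : (c.+1%:R : rat) != 0 by rewrite pnatr_eq0.
  rewrite mul1r unit_integral_pow0 factS natrM fact0.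
  by field; rewrite nat1r c0 natf_fact_neq0.
have := unit_integral_deriv ('X^(j.+1) * (1 - 'X) ^+ c.+1).
rewrite !hornerE ?subrr ?expr0n ?expr1n /= mulr0 mul0r subrr.
have -> : ('X^(j.+1) * (1 - 'X) ^+ c.+1)^`() =
    ('X^j * (1 - 'X) ^+ c.+1) *+ j.+1
    - ('X^(j.+1) * (1 - 'X) ^+ c) *+ c.+1 :> {poly rat}.
  by rewrite derivM !deriv_exp derivB !derivC !derivX /=; ring.
rewrite linearB !linearMn /= -!(mulr_natr (unit_integral _)).
move/eqP; rewrite subr_eq0 => /eqP E; apply: (mulIf c0); rewrite -E IH addSnnS.
have N0 := natf_fact_neq0 (j + c.+1).+1; rewrite {IH E}.
set N : rat := (j + c.+1).+1`!%:R in N0 *; clearbody N.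
by rewrite !factS !natrM; field.
Qed.

Lemma poch_fact (n k : nat) : poch (n%:R + 1 : rat) k * n`!%:R = (n + k)`!%:R.
Proof.
rewrite /poch; elim: k => [|k IH]; first by rewrite big_ord0 mul1r addn0.
rewrite big_ord_recr /= mulrAC IH addnS factS natrM.
by ring.
Qed.

(* Both sides are the integral of (1 - x)^(m + 1) (1 - x^2)^p over [0, 1]. *)
Lemma alternating_beta_sum m p :
  \sum_(k < p.+1) 'C(p, k)%:R * ((-1) ^+ k * (2 * k)`!%:R / poch (m%:R + 2) (2 * k).+1) =
  p`!%:R * (m + p).+1`!%:R / (m + 2 * p + 2)`!%:R
  * (binz_sum (m + 2 * p + 2) p 0)%:R :> rat.
Proof.
have -> : (m + 2 * p + 2 = ((m + p).+1 + p).+1)%N by lia.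
rewrite -unit_integral_pow.
have -> : (1 - 'X) ^+ (m + p).+1 * (1 + 'X) ^+ p =
   \sum_(k < p.+1) ((-1) ^+ k *+ 'C(p, k)) *: ('X^(2 * k) * (1 - 'X) ^+ m.+1) :> {poly rat}.
  rewrite -addSn exprD -mulrA -exprMn.
  have -> : (1 - 'X) * (1 + 'X) = 1 - 'X^2 :> {poly rat} by ring.
  rewrite [(1 - 'X^2) ^+ p]exprBn mulr_sumr; apply: eq_bigr => k _.
  rewrite expr1n mulr1 -exprM -mul_polyC polyCMn polyC_exp polyCN polyC1.
  by ring.
rewrite linear_sum; apply: eq_bigr => k _.
rewrite linearZ /= unit_integral_beta -mulr_natr.
have := poch_fact m.+1 (2 * k).+1.
have -> : m.+1%:R + 1 = m%:R + 2 :> rat by ring.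
have -> : (m.+1 + (2 * k).+1 = (2 * k + m.+1).+1)%N by lia.
move=> <-; have := natf_fact_neq0 (m.+1 + (2 * k).+1).
rewrite -poch_fact mulf_eq0 negb_or => /andP[].
have -> : m.+1%:R + 1 = m%:R + 2 :> rat by ring.
by move=> ? ?; field; apply/andP.
Qed.

End BetaIntegrals.

(** * Rank sequences and the cost recursion *)

Section Codes.

Local Open Scope ring_scope.

(* [s] is the word of the entries processed so far and the number of exchanges;
   [o] is the row and the rank of the next entry. *)
Definition word_step (s : seq bool * nat) (o : bool * nat) : seq bool * nat :=
  if o.1 then (slide_word 0 s.1 o.2, (s.2 + slide_cost 0 s.1 o.2)%N)
  else (insert_down s.1 o.2, (s.2 + downs_before s.1 o.2)%N).

Lemma size_insert_down P t : size (insert_down P t) = (size P).+1.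
Proof. by elim: P t => [|x P IH] [|t] //=; rewrite IH. Qed.

Lemma size_slide_word h P t : size (slide_word h P t) = (size P).+1.
Proof.
elim: P h t => [|[] P IH] h [|t] //=; first by rewrite IH.
by case: h => [|h] /=; rewrite ?IH ?size_insert_down.
Qed.

Lemma size_word_step s o : size (word_step s o).1 = (size s.1).+1.
Proof. by rewrite /word_step; case: ifP; rewrite (size_slide_word, size_insert_down). Qed.

(** The range of each rank is read off the current word, so that sums over consecutive blocks of
    operations compose. *)
Fixpoint code_sum (ops : seq bool) (s : seq bool * nat)
    (G : seq bool * nat -> rat) : rat :=
  if ops is o :: ops' then
    \sum_(t < (size s.1).+1) code_sum ops' (word_step s (o, t : nat)) G
  else G s.

Fixpoint codes (k r : nat) : seq (seq nat) :=
  if r is r'.+1 then [seq t :: c | t <- iota 0 k.+1, c <- codes k.+1 r']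
  else [:: [::]].

Lemma size_codes k r : (size (codes k r) * k`! = (k + r)`!)%N.
Proof.
elim: r k => [|r IH] k; first by rewrite mul1n addn0.
by rewrite [size _](size_allpairs cons (iota 0 k.+1)) size_iota mulnAC -factS mulnC IH addSnnS.
Qed.

Lemma codes_uniq k r : uniq (codes k r).
Proof.
elim: r k => [|r IH] k //; apply: allpairs_uniq => //; first exact: iota_uniq.
by move=> [t c] [t' c'] _ _ [-> ->].
Qed.

Lemma codes_sum ops s G :
  \sum_(c <- codes (size s.1) (size ops)) G (foldl word_step s (zip ops c)) =
  code_sum ops s G.
Proof.
elim: ops s => [|o ops IH] s; first by rewrite big_seq1.
rewrite [LHS]big_allpairs_dep -[RHS](big_mkord xpredT
  (fun t => code_sum ops (word_step s (o, t)) G)) /index_iota subn0.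
by apply: eq_bigr => t _; rewrite -IH size_word_step.
Qed.

Lemma code_sum_cat ops ops' s G :
  code_sum (ops ++ ops') s G = code_sum ops s (fun s' => code_sum ops' s' G).
Proof.
by elim: ops s => //= o ops IH s; apply: eq_bigr => t _; apply: IH.
Qed.

Lemma eq_code_sum ops s G G' :
    (forall s', size s'.1 = (size s.1 + size ops)%N -> G s' = G' s') ->
  code_sum ops s G = code_sum ops s G'.
Proof.
elim: ops s => [|o ops IH] s eqG /=; first by apply: eqG; rewrite addn0.
apply: eq_bigr => t _; apply: IH => s' ss'; apply: eqG.
by rewrite ss' size_word_step addSnnS.
Qed.

Lemma code_sumD ops s G G' :
  code_sum ops s (fun s' => G s' + G' s') = code_sum ops s G + code_sum ops s G'.
Proof.
by elim: ops s => //= o ops IH s; rewrite -big_split; apply: eq_bigr.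
Qed.

Lemma code_sumZ ops s c G :
  code_sum ops s (fun s' => c * G s') = c * code_sum ops s G.
Proof.
by elim: ops s => //= o ops IH s; rewrite mulr_sumr; apply: eq_bigr.
Qed.

Lemma slide_word_nseq h k t : (t <= k)%N ->
  slide_word h (nseq k true) t = nseq k.+1 true.
Proof. by elim: k h t => [|k IH] h [|t] //= /IH->. Qed.

Lemma slide_cost_nseq h k t : (t <= k)%N -> slide_cost h (nseq k true) t = t.
Proof. by elim: k h t => [|k IH] h [|t] //= /IH->. Qed.

Lemma code_sum_ups_word m (F : seq bool -> rat) :
  code_sum (nseq m true) ([::], 0%N) (fun s => F s.1) = m`!%:R * F (nseq m true).
Proof.
elim: m F => [|m IH] F; first by rewrite mul1r.
rewrite [nseq m.+1 true in X in X = _](_ : _ = nseq m true ++ [:: true]); last first.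
  by rewrite -addn1 nseqD.
rewrite code_sum_cat /=.
rewrite (IH (fun W => \sum_(t < (size W).+1) F (slide_word 0 W t))) size_nseq.
rewrite (eq_bigr (fun=> F (nseq m.+1 true))); last first.
  by move=> t _; rewrite slide_word_nseq // -ltnS.
by rewrite sumr_const card_ord factS natrM; ring.
Qed.

(** A single row is sorted by insertion, with m(m - 1)/4 exchanges on average. *)
Lemma code_sum_ups_cost m :
  code_sum (nseq m true) ([::], 0%N) (fun s => s.2%:R) =
  m`!%:R * (m%:R * (m%:R - 1) / 4).
Proof.
elim: m => [|m IH]; first by rewrite /=; field.
rewrite [nseq m.+1 true in X in X = _](_ : _ = nseq m true ++ [:: true]); last first.
  by rewrite -addn1 nseqD.
rewrite code_sum_cat /=.
rewrite (eq_code_sum (G' := fun s => m.+1%:R * s.2%:R +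
    \sum_(t < m.+1) (slide_cost 0 s.1 t)%:R)); last first.
  move=> s; rewrite size_nseq add0n => ->.
  under eq_bigr do rewrite natrD.
  by rewrite big_split sumr_const card_ord mulr_natl.
rewrite code_sumD code_sumZ IH.
rewrite (code_sum_ups_word m (fun W => \sum_(t < m.+1) (slide_cost 0 W t)%:R)).
rewrite (eq_bigr (fun t : 'I_m.+1 => 0 + 1 * t%:R)); last first.
  by move=> t _; rewrite slide_cost_nseq -1?ltnS //; ring.
by rewrite sum_affine factS natrM; field.
Qed.

Lemma ballot_sum_ups n h (F : seq bool -> rat) :
  ballot_sum n 0 h F = F (nseq n true).
Proof.
elim: n h F => [|n IH] h F //.
by rewrite ballot_sumS IH addr0.
Qed.

(** For m = l1 - l2 and p = l2: the m columns of one cell come first, then the columns of two cells,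
    each with its lower cell before the upper one. *)
Definition shape_ops (m p : nat) : seq bool :=
  nseq m true ++ flatten (nseq p [:: false; true]).

Lemma shape_opsS m p : shape_ops m p.+1 = shape_ops m p ++ [:: false; true].
Proof. by rewrite /shape_ops -addn1 nseqD flatten_cat catA. Qed.

Lemma size_shape_ops m p : size (shape_ops m p) = (m + 2 * p)%N.
Proof.
elim: p => [|p IH]; first by rewrite /shape_ops cats0 size_nseq addn0.
by rewrite shape_opsS size_cat IH /=; lia.
Qed.

(** Here i and f are the costs of the lower and the upper cell. The word Q between the two
    insertions has one preimage for each i < w, where w = [hit 0 Q]. *)
Lemma ballot_sum_column n p (G : nat -> seq bool -> rat) :
  ballot_sum n p 0 (fun P => \sum_(s < n.+1) \sum_(t < n.+2)
    G (downs_before P s + slide_cost 0 (insert_down P s) t)%N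
      (slide_word 0 (insert_down P s) t)) =
  ballot_sum n.+2 p.+1 0
    (fun R => slide_sum 0 R (fun w f => \sum_(i < w) G (i + f)%N R)).
Proof.
rewrite -(ballot_sum_slide n.+1 p.+1 0 (fun w f R => \sum_(i < w) G (i + f)%N R)).
rewrite (ballot_sum_insert_down n p 0
  (fun i Q => \sum_(t < n.+2) G (i + slide_cost 0 Q t)%N (slide_word 0 Q t))).
by apply: eq_ballot_sum => Q _ _ _; rewrite exchange_big.
Qed.

(* The number of rank sequences that lead to any given ballot path, see
   [code_sum_word]. *)
Definition multiplicity (m p : nat) : rat := p`!%:R * (m + p).+1`!%:R / m.+1%:R.

Lemma multiplicityS m p :
  multiplicity m p.+1 = multiplicity m p * (p.+1%:R * (m + p).+2%:R).
Proof.
rewrite /multiplicity addnS [in LHS]factS [in LHS](factS (m + p).+1) !natrM.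
by ring.
Qed.

Lemma slide_sumZ h R (c : rat) G :
  slide_sum h R (fun w f => c * G w f) = c * slide_sum h R G.
Proof.
elim: R h G => [|[] R IH] h G /=; first by rewrite mulr0.
  rewrite IH !mulrDr; congr (_ + _ + _).
  by case: h => [|h]; rewrite ?mulr0 ?mulr_sumr.
by case: h => [|h]; rewrite ?mulr0 ?IH.
Qed.

Lemma ballot_sumZ n b h c (F : seq bool -> rat) :
  ballot_sum n b h (fun R => c * F R) = c * ballot_sum n b h F.
Proof.
elim: n b h F => [|n IH] b h F /=; first by case: eqP; rewrite ?mulr0.
rewrite IH mulrDr; congr (_ + _).
by case: b => [|b]; case: h => [|h]; rewrite ?mulr0 ?IH.
Qed.

(** A new column multiplies the number of rank sequences by the weight (p + 1)(m + p + 2), the same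
    for every path. With F = 1 this is the hook length formula for the shape (m + p, p). *)
Lemma code_sum_word m p (F : seq bool -> rat) :
  code_sum (shape_ops m p) ([::], 0%N) (fun s => F s.1) =
  multiplicity m p * ballot_sum (m + 2 * p) p 0 F.
Proof.
elim: p F => [|p IH] F.
  rewrite /shape_ops cats0 code_sum_ups_word ballot_sum_ups addn0; congr (_ * _).
  rewrite /multiplicity addn0 factS natrM fact0 mul1r mulrAC divff ?mul1r //.
  by rewrite pnatr_eq0.
set n := (m + 2 * p)%N; have -> : (m + 2 * p.+1 = n.+2)%N by rewrite /n; lia.
rewrite shape_opsS code_sum_cat.
rewrite (eq_code_sum (G' := fun s => (fun P => \sum_(s < n.+1) \sum_(t < n.+2)
    F (slide_word 0 (insert_down P s) t)) s.1)); last first.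
  move=> s; rewrite size_shape_ops add0n -/n => sz.
  by rewrite /= sz; apply: eq_bigr => t _; rewrite size_insert_down sz.
rewrite (IH (fun P => \sum_(s < n.+1) \sum_(t < n.+2)
    F (slide_word 0 (insert_down P s) t))).
rewrite (ballot_sum_column n p (fun=> F)) multiplicityS -mulrA -[X in _ = _ * X]ballot_sumZ.
congr (_ * _); apply: eq_ballot_sum => R sR dR bR.
rewrite (eq_slide_sum _ R (G' := fun w f => F R * (w + 0)%:R)); last first.
  by move=> w f; rewrite sumr_const card_ord addn0 mulr_natr.
rewrite slide_sumZ slide_sum_weight // sR dR /n /=.
by ring.
Qed.

(** The difference of binomials counts the ballot paths, and (m + 1) times the partial sum is the
    total of [quad] over them. *)
Definition column_cost (m p : nat) : rat :=
  let b := p.+1%:R in let a := m%:R + b in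
  let n := (m + 2 * p).+2 in
  (b * (a * (a + b - 2) + b + 1) * ((binz n p.+1 0)%:R - (binz n p 0)%:R)
   + 4 * (m.+1%:R * (binz_sum n p 1)%:R)) / 2.

Lemma ballot_sum_column_cost m p :
  ballot_sum (m + 2 * p).+2 p.+1 0
    (fun R => slide_sum 0 R (fun w f => \sum_(i < w) (i + f)%:R)) =
  column_cost m p.
Proof.
set n := (m + 2 * p)%N.
have le_p : (2 * p.+1 <= n.+2 + 0 + 1)%N by rewrite /n; lia.
rewrite (eq_ballot_sum (F' := fun R => 1 / 2 * (p.+1%:R *
   ((m%:R + p.+1%:R) * (m%:R + 2 * p.+1%:R - 2) + p.+1%:R + 1) + 4 * quad 0 R))); last first.
  move=> R sR dR bR.
  rewrite (eq_slide_sum _ R (G' := fun w f => 1 / 2 *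
     (2 * (w%:R + 0%:R) * (f%:R + 0%:R + 0%:R) + (w%:R + 0%:R) * (w%:R + 0%:R - 1)))); last first.
    move=> w f; rewrite (eq_bigr (fun i : 'I_w => f%:R + 1 * i%:R)) ?sum_affine; first by field.
    by move=> i _; ring.
  by rewrite slide_sumZ slide_sum_cost // sR dR /cost_form /n /=; field.
rewrite ballot_sumZ ballot_sumD ballot_sum_const ballot_sumZ ballot_sum1 // ballot_sum_quad //.
rewrite binzSS !binz_sumSS /column_cost -/n.
have -> : n.+2%:R = m%:R + 2 * p%:R + 2 :> rat by rewrite /n; ring.
by field.
Qed.

(** Every earlier exchange is counted once for each pair of ranks in the new column; the new
    exchanges depend only on the word. *)
Lemma code_sum_cost_rec m p :
  code_sum (shape_ops m p.+1) ([::], 0%N) (fun s => s.2%:R) =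
  (m + 2 * p).+1%:R * (m + 2 * p).+2%:R *
    code_sum (shape_ops m p) ([::], 0%N) (fun s => s.2%:R) +
  multiplicity m p * column_cost m p.
Proof.
set n := (m + 2 * p)%N.
rewrite -ballot_sum_column_cost -(ballot_sum_column n p (fun k _ => k%:R)) -code_sum_word.
rewrite shape_opsS code_sum_cat -code_sumZ -code_sumD.
apply: eq_code_sum => s; rewrite size_shape_ops add0n -/n => sz.
rewrite /= sz (eq_bigr (fun t : 'I_n.+1 => n.+2%:R * s.2%:R +
   \sum_(t0 < n.+2) (downs_before s.1 t + slide_cost 0 (insert_down s.1 t) t0)%:R)).
  by rewrite big_split sumr_const card_ord; congr (_ + _); ring.
move=> t _; rewrite size_insert_down sz.
under eq_bigr do rewrite -addnA natrD.
by rewrite big_split sumr_const card_ord mulr_natl.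
Qed.

End Codes.

(** * The stated formula satisfies the same recursion *)

Section TwoRowFormula.

Local Open Scope ring_scope.

Definition two_row_formula (l1 l2 : nat) : rat :=
  l1%:R * (l1%:R - 1) / 4 + l2%:R * (l2%:R - 3) / 4
     - 2 * \sum_(1 <= k < l2.+1)
             'C(l2, k)%:R
             * ((-1) ^+ k * ((2 * k - 2)`!)%:R
                / poch (l1%:R - l2%:R + 2) (2 * k - 1)).

(** As l1 - l2 = m is kept, the Pochhammer symbols do not change, and Pascal's rule gives the
    increment of the sum. *)
Lemma two_row_formulaS m p :
  two_row_formula (m + p.+1) p.+1 = two_row_formula (m + p) p +
    (m%:R + 2 * p%:R - 1) / 2 +
    2 * \sum_(k < p.+1)
      'C(p, k)%:R * ((-1) ^+ k * (2 * k)`!%:R / poch (m%:R + 2) (2 * k).+1).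
Proof.
rewrite /two_row_formula.
have -> : (m + p.+1)%:R - p.+1%:R + 2 = m%:R + 2 :> rat by ring.
have -> : (m + p)%:R - p%:R + 2 = m%:R + 2 :> rat by ring.
pose g k : rat := (-1) ^+ k * (2 * k)`!%:R / poch (m%:R + 2) (2 * k).+1.
have sumE q : \sum_(1 <= k < q.+1) 'C(q, k)%:R * ((-1) ^+ k * ((2 * k - 2)`!)%:R
    / poch (m%:R + 2) (2 * k - 1)) = - \sum_(k < q) 'C(q, k.+1)%:R * g k.
  rewrite big_add1 big_mkord -sumrN; apply: eq_bigr => k _; rewrite /g.
  have -> : (2 * k.+1 - 2 = 2 * k)%N by lia.
  have -> : (2 * k.+1 - 1 = (2 * k).+1)%N by lia.
  by rewrite exprS; ring.
rewrite !sumE -/(g _).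
have -> : \sum_(k < p.+1) 'C(p.+1, k.+1)%:R * g k =
    \sum_(k < p) 'C(p, k.+1)%:R * g k + \sum_(k < p.+1) 'C(p, k)%:R * g k.
  under eq_bigr do rewrite binS natrD mulrDl.
  by rewrite big_split big_ord_recr /= bin_small // mul0r addr0.
by rewrite /g; field.
Qed.

Lemma column_cost_formula m p :
  multiplicity m p * column_cost m p = (m + 2 * p).+2`!%:R *
   ((m%:R + 2 * p%:R - 1) / 2 +
    2 * \sum_(k < p.+1)
      'C(p, k)%:R * ((-1) ^+ k * (2 * k)`!%:R / poch (m%:R + 2) (2 * k).+1)).
Proof.
rewrite alternating_beta_sum addn2 binz_sumE natrD /column_cost /multiplicity.
set n := (m + 2 * p).+2.
have n0 := natf_fact_neq0 n.
have Ep : 'C(n, p)%:R = n`!%:R / (p`!%:R * ((m + p).+2%:R * (m + p).+1`!%:R)) :> rat.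
  have le_p : (p <= n)%N by rewrite /n; lia.
  rewrite -(bin_fact le_p) -natrM -factS.
  have -> : (n - p = (m + p).+2)%N by rewrite /n; lia.
  by rewrite -natrM [in RHS]natrM mulfK // natrM mulf_neq0 ?natf_fact_neq0.
have EpS : 'C(n, p.+1)%:R = n`!%:R / (p.+1%:R * p`!%:R * (m + p).+1`!%:R) :> rat.
  have le_p : (p.+1 <= n)%N by rewrite /n; lia.
  rewrite -(bin_fact le_p) -natrM -factS.
  have -> : (n - p.+1 = (m + p).+1)%N by rewrite /n; lia.
  by rewrite -natrM [in RHS]natrM mulfK // natrM mulf_neq0 ?natf_fact_neq0.
rewrite /binz !subn0 !leq0n Ep EpS.
have := natf_fact_neq0 (m + p).+1; have := natf_fact_neq0 p.
(* The partial sum B has the same coefficient on both sides; what remains is a rational identity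
   with the factorials as nonzero unknowns. *)
move: n0 (binz_sum n p 1)%:R; clear; clearbody n.
move: n`!%:R p`!%:R (m + p).+1`!%:R => F P M F0 B P0 M0.

by field; rewrite P0 F0 M0 -natrD -natrD !nat1r !pnatr_eq0.
Qed.

Lemma code_sum_cost m p :
  code_sum (shape_ops m p) ([::], 0%N) (fun s => s.2%:R) =
  (m + 2 * p)`!%:R * two_row_formula (m + p) p.
Proof.
elim: p => [|p IH].
  rewrite /shape_ops cats0 code_sum_ups_cost !addn0 /two_row_formula big_geq //.
  by congr (_ * _); field.
rewrite code_sum_cost_rec IH column_cost_formula two_row_formulaS.
have -> : (m + 2 * p.+1 = (m + 2 * p).+2)%N by lia.
rewrite !factS !natrM.
by ring.
Qed.

End TwoRowFormula.

(** * Words lifted to sorted lists of actual entries *)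

Section TaggedLists.

(* Processed entries in increasing order, each tagged with its row as in the
   words. *)
Implicit Types (M : seq (bool * nat)) (s : seq nat).

Definition tags M : seq bool := [seq v.1 | v <- M].
Definition values M : seq nat := [seq v.2 | v <- M].
Definition tagged_row (r : bool) M : seq nat := [seq v.2 | v <- M & v.1 == r].

Definition rank (k : nat) s : nat := count (fun x => x < k) s.

Fixpoint insert (k : nat) s : seq nat :=
  if s is x :: s' then if x < k then x :: insert k s' else k :: s else [:: k].

Fixpoint tag_insert M (k : nat) : seq (bool * nat) :=
  if M is x :: M' then if x.2 < k then x :: tag_insert M' k else (false, k) :: M
  else [:: (false, k)].

Fixpoint tag_slide (h : nat) M (k : nat) : seq (bool * nat) :=
  match M with
  | (true, x) :: M' =>
      if x < k then (true, x) :: tag_slide h.+1 M' k else (true, k) :: M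
  | (false, y) :: M' =>
      if y < k then
        if h is h'.+1 then (false, y) :: tag_slide h' M' k
        else (true, y) :: tag_insert M' k
      else (true, k) :: M
  | [::] => [:: (true, k)]
  end.

Lemma rank_cons k x s : rank k (x :: s) = (x < k) + rank k s.
Proof. by []. Qed.

Lemma rank_eq0 k s : all (leq k) s -> rank k s = 0.
Proof.
by move=> /allP le_k; apply/eqP; rewrite -leqn0 leqNgt -has_count;
   apply/hasPn => x /le_k; rewrite -leqNgt.
Qed.

Lemma sorted_all_leq k x s : sorted ltn (x :: s) -> k <= x -> all (leq k) (x :: s).
Proof.
rewrite /= (path_sortedE ltn_trans) => /andP[/allP lt_x _] le_k; rewrite le_k /=.
by apply/allP => y /lt_x /ltnW; apply: leq_trans.
Qed.

Lemma perm_insert k s : perm_eq (insert k s) (k :: s).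
Proof.
elim: s => //= x s IH; case: ifP => // _.
by apply/seq.permP => a; move/seq.permP: IH => /(_ a) /= ->; rewrite addnCA.
Qed.

Lemma sorted_insert k s : sorted ltn s -> k \notin s -> sorted ltn (insert k s).
Proof.
elim: s => //= x s IH; rewrite in_cons negb_or => px /andP[kx ks].
case: ltnP => [xk|]; last by rewrite leq_eqVlt (negbTE kx) /= => ->.
move: px; rewrite /= !(path_sortedE ltn_trans) => /andP[lt_x ss].
rewrite IH // andbT (perm_all _ (perm_insert k s)) /= lt_x andbT.
exact: xk.
Qed.

Lemma values_tag_insert M k : values (tag_insert M k) = insert k (values M).
Proof. by elim: M => //= x M IH; case: ifP => //= _; rewrite -IH. Qed.

Lemma values_tag_slide h M k : values (tag_slide h M k) = insert k (values M).
Proof.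
elim: M h => [|[[] x] M IH] h //=; first by case: ifP => //= _; rewrite -(IH h.+1).
by case: ifP => //= _; case: h => [|h] /=; rewrite -?(IH h) // -values_tag_insert.
Qed.

Lemma tags_tag_insert M k : sorted ltn (values M) ->
  tags (tag_insert M k) = insert_down (tags M) (rank k (values M)).
Proof.
elim: M => // x M IH sM; have sM' := path_sorted sM.
case: (ltnP x.2 k) => [xk|kx]; first by rewrite rank_cons xk /= xk /= IH.
by rewrite rank_eq0 /=; [rewrite ltnNge kx|apply: sorted_all_leq].
Qed.

Lemma tags_tag_slide h M k : sorted ltn (values M) ->
  tags (tag_slide h M k) = slide_word h (tags M) (rank k (values M)).
Proof.
elim: M h => // [[r x] M] IH h sM.
have sM' := path_sorted sM.
case: (ltnP x k) => [xk|kx]; last first.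
  by rewrite rank_eq0; [case: r {sM} => /=; rewrite ltnNge kx|exact: sorted_all_leq].
have -> : rank k (values ((r, x) :: M)) = (rank k (values M)).+1.
    by rewrite rank_cons xk.
case: r {sM} => /=; rewrite xk /=; first by rewrite -IH.
by case: h => [|h] /=; rewrite -?IH // -tags_tag_insert.
Qed.

Lemma tagged_row_insert M k : sorted ltn (values M) ->
  tagged_row false (tag_insert M k) = insert k (tagged_row false M).
Proof.
elim: M => // [[r x] M] IH sM; have sM' := path_sorted sM.
rewrite /=; case: ltnP => [xk|kx].
  rewrite /tagged_row /=; case: r {sM} => /=; rewrite ?xk;
    by move: (IH sM'); rewrite /tagged_row => ->.
have /allP le_k : all (leq k) (values ((r, x) :: M)) by apply: sorted_all_leq.
rewrite [LHS](_ : _ = k :: tagged_row false ((r, x) :: M)) //.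
case E: (tagged_row _ _) => [|y s] //=; rewrite ltnNge le_k //.
have : y \in tagged_row false ((r, x) :: M) by rewrite E mem_head.
by case/mapP => v; rewrite mem_filter => /andP[_ vM] ->; apply: map_f.
Qed.

Lemma tagged_row_insert_true M k : tagged_row true (tag_insert M k) = tagged_row true M.
Proof.
elim: M => // [[r x] M] IH /=; case: ifP => // _.
by rewrite /tagged_row /=; case: r => /=; move: IH; rewrite /tagged_row => ->.
Qed.

Lemma downs_before_rank M k : sorted ltn (values M) ->
  downs_before (tags M) (rank k (values M)) = rank k (tagged_row false M).
Proof.
elim: M => // [[r x] M] IH sM; have sM' := path_sorted sM.
case: (ltnP x k) => [xk|kx].
  have -> : rank k (values ((r, x) :: M)) = (rank k (values M)).+1.
    by rewrite rank_cons xk.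
  rewrite /= IH // /tagged_row /=; case: r {sM} => //=.
  by rewrite /rank /= xk.
have /allP le_k : all (leq k) (values ((r, x) :: M)) by apply: sorted_all_leq.
rewrite rank_eq0; last exact/allP.
rewrite /= rank_eq0 //; apply/allP => y.
by case/mapP => v; rewrite mem_filter => /andP[_ vM] ->; apply/le_k/map_f.
Qed.

(** These h entries of row 2 lie to the left of the sliding entry, which never meets them. *)
Lemma take_tag_slide h M k :
  take h (tagged_row false (tag_slide h M k)) = take h (tagged_row false M).
Proof.
elim: M h => [|[[] x] M IH] h; first by [].
  rewrite /=; case: ifP => // _.
  rewrite /tagged_row /= -!/(tagged_row false _).
  have takeS s : take h s = take h (take h.+1 s).
    by rewrite -take_min (minn_idPl (leqnSn h)).
  by rewrite takeS IH -takeS.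
rewrite /=; case: ifP => // _; case: h => [|h]; first by rewrite !take0.
by rewrite /tagged_row /= -!/(tagged_row false _) IH.
Qed.

(** A slide that turns down after u up steps has left h + u entries of row 2 behind; the turn costs
    one exchange and is followed by at most [downs Q] - h - u - 1 others. *)
Lemma slide_cost_le h Q t :
  slide_cost h Q t <= maxn (count id Q) (downs Q - h).
Proof.
have le_downs P r : downs_before P r <= downs P.
  by elim: P r => [|x P IH] [|r] //=; rewrite leq_add2l.
rewrite /downs; elim: Q h t => [|[] Q IH] h [|t] //=.
  by have := IH h.+1 t; lia.
rewrite !add0n add1n; case: h => [|h]; last by rewrite subSS.
by rewrite subn0 leq_max ltnS orbC [_ <= _]le_downs.
Qed.

End TaggedLists.

(** * Entries by coordinates and single moves of the algorithm *)

Section Entries.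

Variable la : seq nat.
Implicit Types (S : filling la) (c d e : cell la).

Definition cell_at (i j : nat) : option (cell la) :=
  [pick c | (crow c == i) && (ccol c == j)].

(* Off the shape the value is [sumn la], which exceeds every entry. *)
Definition entry S (i j : nat) : nat :=
  if cell_at i j is Some c then S c : nat else sumn la.

Definition row_from S (i j : nat) : seq nat :=
  [seq entry S i j' | j' <- iota j (nth 0 la i - j)].

Lemma cell_inj c d : crow c = crow d -> ccol c = ccol d -> c = d.
Proof.
case: c d => [[i j] ij] [[i' j'] ij'] /= ii jj; apply: val_inj => /=.
by congr (_, _); apply: ord_inj.
Qed.

Lemma cell_atK c : cell_at (crow c) (ccol c) = Some c.
Proof.
rewrite /cell_at; case: pickP => [d /andP[/eqP dr /eqP dc]|/(_ c)].
  by congr Some; apply: cell_inj.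
by rewrite !eqxx.
Qed.

Lemma cell_atP i j c : cell_at i j = Some c -> crow c = i /\ ccol c = j.
Proof. by rewrite /cell_at; case: pickP => // d /andP[/eqP <- /eqP <-] [<-]. Qed.

Lemma cell_at_shape i j c : cell_at i j = Some c -> j < nth 0 la i.
Proof. by case/cell_atP => <- <-; apply: (valP c). Qed.

Lemma cell_at_None i j : i < size la -> j < head 0 la -> j < nth 0 la i ->
  exists c, cell_at i j = Some c.
Proof.
move=> isz jh ij.
have [c [ci cj]] : exists c : cell la, crow c = i /\ ccol c = j.
  pose p : 'I_(size la) * 'I_(head 0 la) := (Ordinal isz, Ordinal jh).
  have pP : p.2 < nth 0 la p.1 by [].
  by exists (exist _ p pP).
by exists c; rewrite -ci -cj cell_atK.
Qed.

Lemma entry_cell S c : entry S (crow c) (ccol c) = S c.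
Proof. by rewrite /entry cell_atK. Qed.

Lemma entry_le S i j : entry S i j <= sumn la.
Proof. by rewrite /entry; case: cell_at => // c; apply/ltnW/ltn_ord. Qed.

Lemma entry_ltP S i j (k : nat) : entry S i j = k -> k < sumn la ->
  exists c, [/\ cell_at i j = Some c, crow c = i, ccol c = j & S c = k :> nat].
Proof.
rewrite /entry; case E: cell_at => [c|] <-; last by rewrite ltnn.
by move=> _; exists c; have [-> ->] := cell_atP E.
Qed.

Lemma entry_shape S i j : entry S i j < sumn la -> j < nth 0 la i.
Proof. by case/(entry_ltP erefl) => c [/cell_at_shape]. Qed.

Lemma row_from_cons S i j : j < nth 0 la i ->
  row_from S i j = entry S i j :: row_from S i j.+1.
Proof. by move=> ij; rewrite /row_from -(subnSK ij). Qed.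

Lemma row_from_nil S i j : nth 0 la i <= j -> row_from S i j = [::].
Proof. by rewrite /row_from -subn_eq0 => /eqP->. Qed.

Lemma row_from_S S i j : row_from S i j.+1 = behead (row_from S i j).
Proof.
case: (ltnP j (nth 0 la i)) => ij; first by rewrite (row_from_cons S ij).
by rewrite (row_from_nil S ij) (row_from_nil S (leqW ij)).
Qed.

Lemma entry_head S i j : head (sumn la) (row_from S i j) = entry S i j.
Proof.
case: (ltnP j (nth 0 la i)) => ij; first by rewrite row_from_cons.
rewrite row_from_nil // /entry; case E: cell_at => [c|] //.
by move: (cell_at_shape E); rewrite ltnNge ij.
Qed.

Lemma eq_row_from S S' i j :
  (forall j', j <= j' -> entry S i j' = entry S' i j') ->
  row_from S i j = row_from S' i j.
Proof. by move=> eqS; apply/eq_in_map => j'; rewrite mem_iota => /andP[/eqS]. Qed.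

Lemma entry_exchange S c d i j : entry (exchange S c d) i j =
  if (i == crow c) && (j == ccol c) then S d : nat
  else if (i == crow d) && (j == ccol d) then S c : nat else entry S i j.
Proof.
rewrite /entry; case E: cell_at => [e|].
  have [ei ej] := cell_atP E; rewrite ffunE -ei -ej.
  have eqE (f : cell la) : ((crow e == crow f) && (ccol e == ccol f)) = (e == f).
    by apply/andP/eqP => [[/eqP ? /eqP ?]|->] //; apply: cell_inj.
  by rewrite !eqE; case: tpermP => [->|->|/eqP/negbTE-> /eqP/negbTE->] //;
     rewrite eqxx //; case: eqP => // ->.
have ne (f : cell la) : ((i == crow f) && (j == ccol f)) = false.
  by apply/negP => /andP[/eqP fi /eqP fj]; move: E; rewrite fi fj cell_atK.
by rewrite !ne.
Qed.

Lemma nps_step_exchange S c d (k : 'I_(sumn la)) :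
    injective S -> S c = k -> d \in nbrs c -> S d < k ->
    (forall e, e \in nbrs c -> S d <= S e) ->
  nps_step k S = Some (exchange S c d).
Proof.
move=> injS Sc dc dk d_min; rewrite /nps_step.
case: pickP => [c' /eqP|/(_ c)]; last by rewrite Sc eqxx.
rewrite -Sc => /injS ->; rewrite /exchange_cell /corner.
case: eqP => [n0|_]; first by move: dc; rewrite n0 inE.
case: pickP => [d' /and3P[d'c /forall_inP d'_min _]|/(_ d)] /=.
  congr (Some (exchange _ _ _)); apply/injS/ord_inj/eqP.
  by rewrite eqn_leq d_min // d'_min.
by rewrite dc Sc dk andbT /= => /negP[]; apply/forall_inP.
Qed.

Lemma nps_step_stop S c (k : 'I_(sumn la)) :
    injective S -> S c = k -> (forall e, e \in nbrs c -> k <= S e) ->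
  nps_step k S = None.
Proof.
move=> injS Sc k_min; rewrite /nps_step.
case: pickP => [c' /eqP|/(_ c)]; last by rewrite Sc eqxx.
rewrite -{1}Sc => /injS ->; rewrite /exchange_cell; case: ifP => // _.
by case: pickP => //= d /and3P[/k_min kd _]; rewrite Sc ltnNge kd.
Qed.

Lemma nbrs_entry S c e : e \in nbrs c ->
  (S e = entry S (crow c).+1 (ccol c) :> nat) \/
  (S e = entry S (crow c) (ccol c).+1 :> nat).
Proof.
by rewrite inE -entry_cell => /orP[] /andP[/eqP-> /eqP->]; [left|right].
Qed.

(** Missing neighbours have the value [sumn la], so corners need no separate case. *)
Lemma nps_stop S i j (k : 'I_(sumn la)) :
    injective S -> entry S i j = k ->
    k <= entry S i.+1 j -> k <= entry S i j.+1 ->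
  nps_step k S = None.
Proof.
move=> injS /entry_ltP -/(_ (ltn_ord k)) [c [_ ci cj /ord_inj Sc]] le_d le_r.
by apply: (nps_step_stop injS Sc) => e /(nbrs_entry S)[]->; rewrite ci cj.
Qed.

Lemma exchange_inj S c d : injective S -> injective (exchange S c d).
Proof. by move=> injS x y; rewrite !ffunE => /injS/perm_inj. Qed.

Lemma nps_right S i j (k : 'I_(sumn la)) :
    injective S -> entry S i j = k ->
    entry S i j.+1 < k -> entry S i j.+1 <= entry S i.+1 j ->
  exists2 S', nps_step k S = Some S' &
    injective S' /\ forall i' j', entry S' i' j' =
      if (i' == i) && (j' == j) then entry S i j.+1
      else if (i' == i) && (j' == j.+1) then k : nat else entry S i' j'.
Proof.
move=> injS /entry_ltP -/(_ (ltn_ord k)) [c [_ ci cj /ord_inj Sc]] lt_r le_r.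
have [d [_ di dj Sd]] := entry_ltP erefl (ltn_trans lt_r (ltn_ord k)).
exists (exchange S c d); last first.
  split=> [|i' j']; first exact: exchange_inj.
  by rewrite entry_exchange ci cj di dj Sd Sc.
apply: nps_step_exchange => //; rewrite ?Sd //.
  by rewrite inE ci cj di dj !eqxx orbT.
by move=> e /(nbrs_entry S)[]->; rewrite ci cj.
Qed.

Lemma nps_down S i j (k : 'I_(sumn la)) :
    injective S -> entry S i j = k ->
    entry S i.+1 j < k -> entry S i.+1 j <= entry S i j.+1 ->
  exists2 S', nps_step k S = Some S' &
    injective S' /\ forall i' j', entry S' i' j' =
      if (i' == i) && (j' == j) then entry S i.+1 j
      else if (i' == i.+1) && (j' == j) then k : nat else entry S i' j'.
Proof.
move=> injS /entry_ltP -/(_ (ltn_ord k)) [c [_ ci cj /ord_inj Sc]] lt_r le_r.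
have [d [_ di dj Sd]] := entry_ltP erefl (ltn_trans lt_r (ltn_ord k)).
exists (exchange S c d); last first.
  split=> [|i' j']; first exact: exchange_inj.
  by rewrite entry_exchange ci cj di dj Sd Sc.
apply: nps_step_exchange => //; rewrite ?Sd //.
  by rewrite inE ci cj di dj !eqxx.
by move=> e /(nbrs_entry S)[]->; rewrite ci cj.
Qed.

End Entries.

(** * Complete slides on two rows *)

Section TwoRowSlides.

Variables l1 l2 : nat.
Let la : seq nat := [:: l1; l2].
Implicit Types (S : filling la).

Lemma entry_row2 S j : entry S 2 j = sumn la.
Proof.
rewrite /entry; case E: cell_at => [c|] //.
by have [c2 _] := cell_atP E; have := ltn_ord (val c).1; rewrite -/(crow c) c2.
Qed.

Lemma head_leq (k : 'I_(sumn la)) s : all (leq k) s -> k <= head (sumn la) s.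
Proof. by case: s => [_|x s /andP[]] //=; apply: ltnW. Qed.

Lemma slide_row1 Y S j cnt fuel (k : 'I_(sumn la)) :
    injective S -> entry S 1 j = k -> row_from S 1 j.+1 = Y ->
    sorted ltn Y -> rank k Y <= fuel ->
  exists S', [/\ slide fuel k (S, cnt) = (S', cnt + rank k Y), injective S',
    row_from S' 1 j = insert k Y &
    forall i' j', ~~ ((i' == 1) && (j <= j')) -> entry S' i' j' = entry S i' j'].
Proof.
elim: Y S j cnt fuel => [|y Y IH] S j cnt fuel injS Sj rowS sY le_fuel.
  have jl : j < nth 0 la 1 by apply: (entry_shape (S := S)); rewrite Sj.
  exists S; split=> //; last by rewrite row_from_cons // Sj rowS.
  rewrite /rank addn0; case: fuel {le_fuel} => //= fuel.
  rewrite (nps_stop injS Sj) ?entry_row2 ?(ltnW (ltn_ord k)) //.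
  by rewrite -entry_head rowS /= ltnW.
have jl : j < nth 0 la 1 by apply: (entry_shape (S := S)); rewrite Sj.
have Ey : entry S 1 j.+1 = y by rewrite -entry_head rowS.
case: (ltnP y k) => [yk|ky]; last first.
  exists S; rewrite rank_eq0 ?sorted_all_leq // addn0; split=> //.
    case: fuel {le_fuel} => //= fuel.
    by rewrite (nps_stop injS Sj) ?entry_row2 ?Ey ?(ltnW (ltn_ord k)).
  by rewrite row_from_cons // Sj rowS /= ltnNge ky.
case: fuel le_fuel => [|fuel]; rewrite rank_cons yk // => le_fuel.
have [||S1 step [injS1 eS1]] := nps_right injS Sj; rewrite ?Ey //.
  by rewrite entry_row2 -Ey entry_le.
have [||||S' [sl injS' rowS' eS']] := IH S1 j.+1 cnt.+1 fuel injS1.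
- by rewrite eS1 eqxx /= eqn_leq ltnn /= eqxx.
- rewrite -[Y]/(behead (y :: Y)) -rowS -row_from_S; apply: eq_row_from => j' jj'.
  by rewrite eS1 eqxx /= !gtn_eqF // ltnW.
- exact: path_sorted sY.
- exact: le_fuel.
exists S'; split=> //; first by rewrite /= step sl addSnnS.
  rewrite row_from_cons // rowS' eS'; last by rewrite ltnn andbF.
  by rewrite eS1 !eqxx /= yk Ey.
move=> i' j' ne; rewrite eS'; last by apply: contra ne => /andP[-> /ltnW].
rewrite eS1; case: eqP => [i1|] //=; move: ne; rewrite i1 /= -ltnNge => j'j.
by rewrite !ltn_eqF // ltnW.
Qed.

Lemma rows_geq (k : nat) M r : all (leq k) (values M) -> all (leq k) (tagged_row r M).
Proof.
move=> /allP le_k; apply/allP => y /mapP[v].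
by rewrite mem_filter => /andP[_ vM] ->; apply/le_k/map_f.
Qed.

Lemma sorted_tagged_row M r : sorted ltn (values M) -> sorted ltn (tagged_row r M).
Proof. exact/(subseq_sorted ltn_trans)/map_subseq/filter_subseq. Qed.

Lemma all_drop (T : Type) (a : pred T) n s : all a s -> all a (drop n s).
Proof. by rewrite -{1}(cat_take_drop n s) all_cat => /andP[]. Qed.

(* Row 2 is compared with [drop h] of the entries of [M] of row 2, as [h] of
   them lie to the left of the sliding entry. *)
Lemma slide_row0 M h S j cnt fuel (k : 'I_(sumn la)) :
    injective S -> entry S 0 j = k ->
    row_from S 0 j.+1 = tagged_row true M ->
    row_from S 1 j = drop h (tagged_row false M) ->
    sorted ltn (values M) ->
    slide_cost h (tags M) (rank k (values M)) <= fuel ->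
  exists S', [/\ slide fuel k (S, cnt) =
                   (S', cnt + slide_cost h (tags M) (rank k (values M))),
    injective S',
    row_from S' 0 j = tagged_row true (tag_slide h M k),
    row_from S' 1 j = drop h (tagged_row false (tag_slide h M k)) &
    forall i' j', j' < j -> entry S' i' j' = entry S i' j'].
Proof.
elim: M h S j cnt fuel => [|[r x] M IH] h S j cnt fuel injS Sj row0 row1 sM.
  move=> _; have jl : j < nth 0 la 0 by apply: (entry_shape (S := S)); rewrite Sj.
  exists S; split=> //; last by rewrite row_from_cons // Sj row0.
  rewrite addn0; case: fuel => //= fuel.
  by rewrite (nps_stop injS Sj) // -entry_head ?row0 ?row1 /= ltnW.
have jl : j < nth 0 la 0 by apply: (entry_shape (S := S)); rewrite Sj.
case: (ltnP x k) => [xk|kx]; last first.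
  have le_k : all (leq k) (values ((r, x) :: M)) by exact: sorted_all_leq.
  have slideE : tag_slide h ((r, x) :: M) k = (true, k : nat) :: (r, x) :: M.
    by rewrite /= ltnNge kx; case: (r).
  move=> _; exists S; rewrite slideE rank_eq0 //.
  have -> : slide_cost h (tags ((r, x) :: M)) 0 = 0 by rewrite /=; case: (r).
  rewrite addn0; split=> //; last by rewrite row_from_cons // Sj row0.
  case: fuel => //= fuel.
  rewrite (nps_stop injS Sj) // -entry_head ?row0 ?row1; apply: head_leq.
    exact/all_drop/rows_geq.
  exact: rows_geq.
have sM' := path_sorted sM.
have rankE : rank k (values ((r, x) :: M)) = (rank k (values M)).+1.
  by rewrite rank_cons xk.
have x_le : all (leq x) (values ((r, x) :: M)) by apply: sorted_all_leq.
have x_leM : all (leq x) (values M) by case/andP: x_le.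
rewrite rankE; case: r {sM rankE x_le} row0 row1 => row0 row1.
  (* Here x is the right neighbour and the least entry of the list, so the exchange goes right and
     one more entry of row 2 falls behind. *)
  case: fuel => [|fuel] // le_fuel.
  have {}row1 : row_from S 1 j = drop h (tagged_row false M) by [].
  have Ex : entry S 0 j.+1 = x by rewrite -entry_head row0.
  have [||S1 step [injS1 eS1]] := nps_right injS Sj; rewrite ?Ex //.
    rewrite -entry_head row1.
    have : all (leq x) (drop h (tagged_row false M)) by apply/all_drop/rows_geq.
    case: (drop h _) => [_|y s /andP[] //].
    by rewrite /= -Ex entry_le.
  have [|||||S' [sl injS' row0' row1' eS']] := IH h.+1 S1 j.+1 cnt.+1 fuel injS1.
  - by rewrite eS1 eqxx /= eqn_leq ltnn /= eqxx.
  - rewrite [RHS](_ : _ = behead (row_from S 0 j.+1)); last by rewrite row0.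
    rewrite -row_from_S.
    by apply: eq_row_from => j' jj'; rewrite eS1 eqxx /= !gtn_eqF // ltnW.
  - rewrite -[h.+1]add1n -drop_drop -row1 drop1 -row_from_S.
    by apply: eq_row_from => j' jj'; rewrite eS1.
  - exact: sM'.
  - exact: le_fuel.
  exists S'; split=> //; first by rewrite [LHS]/= step sl addSnnS.
  - by rewrite row_from_cons // row0' eS' // eS1 !eqxx /= xk Ex.
  - rewrite /= xk /tagged_row /= -/(tagged_row false _).
    have take1 (s : seq nat) : drop h s = take 1 (drop h s) ++ drop h.+1 s.
      by rewrite -[h.+1]add1n -drop_drop cat_take_drop.
    (* The entry of row 2 in column j is now to the left of the slide and stays in place. *)
    have tk : take 1 (drop h (tagged_row false (tag_slide h.+1 M k))) =
              take 1 (drop h (tagged_row false M)).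
      by rewrite !take_drop add1n take_tag_slide.
    rewrite take1 tk -row1' -row1.
    case: (ltnP j (nth 0 la 1)) => jl2; last first.
      by rewrite !row_from_nil // leqW.
    by rewrite !(row_from_cons _ jl2) /= take0 eS' // eS1.
  - move=> i' j' jj'; rewrite eS'; last exact: ltnW.
    by rewrite eS1 (ltn_eqF jj') (ltn_eqF (leqW jj')) !andbF.
(* For positive height x is already to the left: it leaves the list, and the tableau does not
   change. For height 0 it lies directly below, so the exchange goes down and an insertion in row 2
   follows. *)
case: h row1 => [|h] row1 le_fuel; last first.
  have [S' [sl injS' row0' row1' eS']] := IH h S j cnt fuel injS Sj row0 row1 sM' le_fuel.
  by exists S'; split=> //; rewrite /= xk.
case: fuel le_fuel => [|fuel] // le_fuel.
have {}row0 : row_from S 0 j.+1 = tagged_row true M by [].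
have Ex : entry S 1 j = x by rewrite -entry_head row1.
have [||S1 step [injS1 eS1]] := nps_down injS Sj; rewrite ?Ex //.
  rewrite -entry_head row0.
  have : all (leq x) (tagged_row true M) by apply/rows_geq.
  case: (tagged_row true M) => [_|y s /andP[] //].
  by rewrite /= -Ex entry_le.
have [||||S' [sl injS' row1' eS']] :=
    @slide_row1 (tagged_row false M) S1 j cnt.+1 fuel k injS1.
- by rewrite eS1 eqxx.
- rewrite [RHS](_ : _ = behead (row_from S 1 j)); last by rewrite row1.
  rewrite -row_from_S.
  by apply: eq_row_from => j' jj'; rewrite eS1 /= gtn_eqF.
- exact: sorted_tagged_row.
- by rewrite -downs_before_rank.
exists S'; split=> //.
- by rewrite [LHS]/= step sl -downs_before_rank // addSnnS.
- rewrite /= xk row_from_cons // eS' // eS1 !eqxx /= Ex.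
  rewrite /tagged_row /= -/(tagged_row true _) tagged_row_insert_true -row0.
  congr (_ :: _); apply: eq_row_from => j' jj'.
  by rewrite eS' // eS1 /= gtn_eqF.
- by rewrite row1' drop0 /= xk -tagged_row_insert.
- move=> i' j' jj'; rewrite eS'; last by rewrite [j <= j']leqNgt jj' andbF.
  by rewrite eS1 (ltn_eqF jj') !andbF.
Qed.

End TwoRowSlides.

(** * Rank sequences determine their entries *)

Fixpoint ranks (acc s : seq nat) : seq nat :=
  if s is x :: s' then rank x acc :: ranks (x :: acc) s' else [::].

Lemma ranks_codes acc s : ranks acc s \in codes (size acc) (size s).
Proof.
elim: s acc => // x s IH acc; apply: (allpairs_f cons _ (IH (x :: acc))).
by rewrite mem_iota add0n ltnS count_size.
Qed.

Lemma perm_rank k s s' : perm_eq s s' -> rank k s = rank k s'.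
Proof. by move/seq.permP; apply. Qed.

Lemma rank_lt x y s : x \in s -> x < y -> rank x s < rank y s.
Proof.
move=> xs xy; rewrite (perm_rank x (perm_to_rem xs)) (perm_rank y (perm_to_rem xs)).
rewrite !rank_cons ltnn xy add0n add1n ltnS.
by apply: sub_count => z /= zx; apply: ltn_trans xy.
Qed.

Lemma ranks_inj acc acc' s s' : size s = size s' ->
  perm_eq (acc ++ s) (acc' ++ s') -> ranks acc s = ranks acc' s' ->
  s = s' /\ perm_eq acc acc'.
Proof.
elim: s s' acc acc' => [|x s IH] [|x' s'] acc acc' //=; first by rewrite !cats0.
move=> [sz] perm [rank_x]; rewrite -!cat_rcons -!cats1 in perm.
have shift (y : nat) a t : perm_eq ((a ++ [:: y]) ++ t) ((y :: a) ++ t).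
  by rewrite perm_cat2r cats1 perm_rcons.
move=> /(IH _ _ _ sz)[|-> acc_perm].
  by apply: perm_trans (perm_trans perm (shift _ _ _)); rewrite perm_sym shift.
have xx' : x = x'.
  have := perm_rank x acc_perm; have := perm_rank x' acc_perm.
  have xin : x \in x' :: acc' by rewrite -(perm_mem acc_perm) mem_head.
  case: (ltngtP x x') => // lt _ E.
    by have := rank_lt xin lt; rewrite -E !rank_cons !ltnn rank_x ltnn.
  have := rank_lt (mem_head x' acc') lt.
  by rewrite -E !rank_cons !ltnn rank_x ltnn.
by rewrite xx' in acc_perm *; rewrite perm_cons in acc_perm.
Qed.

(** * From tableaux to rank sequences *)

Section TwoRowRuns.

Variables l1 l2 : nat.
Hypothesis l21 : l2 <= l1.
Let la : seq nat := [:: l1; l2].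
Implicit Types (S T : filling la).

Fixpoint cells_below (j : nat) : seq (nat * nat) :=
  if j is j'.+1 then
    (if j' < l2 then [:: (1, j'); (0, j')] else [:: (0, j')]) ++ cells_below j'
  else [::].

Definition ops_below (j : nat) : seq bool := [seq p.1 == 0 | p <- cells_below j].

Definition coord (c : cell la) : nat * nat := (crow c, ccol c).

Lemma ops_belowE m : ops_below (m + l2) = shape_ops m l2.
Proof.
elim: m => [|m IH]; last first.
  rewrite addSn /ops_below /= ltnNge leq_addl /= -/(ops_below _) IH.
  by rewrite /shape_ops.
rewrite /shape_ops add0n /=; elim: {-2}l2 (leqnn l2) => // j IH jl.
by rewrite /ops_below /= jl /= -/(ops_below _) IH // ltnW.
Qed.

Lemma mem_cells_below j p :
  (p \in cells_below j) = (p.2 < j) && ((p.1 == 0) || (p.1 == 1) && (p.2 < l2)).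
Proof.
case: p => i j'; elim: j => //= j IH.
rewrite mem_cat IH /= ltnS [j' <= j]leq_eqVlt andb_orl; congr (_ || _).
case: ifP => jl; rewrite !inE /= !xpair_eqE; case: (eqVneq j' j) => [->|_];
  by rewrite ?andbF ?andbT ?jl ?andbT ?andbF ?orbF // orbC.
Qed.

Lemma cells_below_uniq j : uniq (cells_below j).
Proof.
elim: j => //= j IH; rewrite cat_uniq IH andbT.
have nin i : (i, j) \in cells_below j = false by rewrite mem_cells_below ltnn.
by case: ifP => _ /=; apply/hasPn => -[i' j'] ij; rewrite !inE /= !xpair_eqE;
   apply/negP; rewrite mem_cells_below in ij; case/andP: ij => /= /ltn_eqF ->; rewrite !andbF.
Qed.

Definition coord_le (p q : nat * nat) : bool :=
  (p.2 < q.2) || ((p.2 == q.2) && (p.1 <= q.1)).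

(** Reversed, both lists are sorted for the antisymmetric order [coord_le] and have the same
    elements. *)
Lemma coord_nps_order : [seq coord c | c <- nps_order la] = cells_below l1.
Proof.
have coord_inj : injective coord by move=> c d [/cell_inj]; apply.
rewrite /nps_order map_rev -[RHS]revK; congr (rev _).
have leT : transitive coord_le by move=> [a b] [c d] [e f]; rewrite /coord_le /=; lia.
apply: (sorted_eq leT).
- by move=> [a b] [c d]; rewrite /coord_le /= => H; congr (_, _); lia.
- rewrite sorted_map; apply: sort_sorted => c d.
  by rewrite /= /coord_le /=; lia.
- rewrite rev_sorted sorted_pairwise; last first.
    by move=> y x z yx zy; apply: leT zy yx.
  elim: l1 => //= j IH; rewrite pairwise_cat IH andbT.
  apply/andP; split; last by case: ifP => //= _; rewrite /coord_le /= eqxx ltnn.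
  apply/allrelP => p [i j'] pin; rewrite mem_cells_below => /andP[/= jj _].
  have pj : p.2 = j by case: ifP pin => _; rewrite !inE; [case/orP|]; move/eqP->.
  by rewrite /= /coord_le /= pj jj.
rewrite perm_sym perm_rev; apply: uniq_perm.
- exact: cells_below_uniq.
- by rewrite map_inj_uniq // sort_uniq enum_uniq.
move=> p; rewrite mem_cells_below (perm_mem (perm_map _ (permEl (perm_sort _ _)))).
apply/idP/mapP => [|[c _ ->]].
  case: p => i j /= /andP[jl ij].
  have [||| c /cell_atP[ci cj]] := @cell_at_None la i j.
  - by case/orP: ij => [/eqP->|/andP[/eqP->]].
  - by [].
  - by case/orP: ij => [/eqP->|/andP[/eqP->]].
  by exists c; rewrite ?mem_enum // /coord ci cj.
have ij : ccol c < nth 0 la (crow c) := valP c.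
have ci : crow c < 2 := ltn_ord _; have cj : ccol c < l1 := ltn_ord _.
by rewrite /= cj; case: (crow c) ci ij => [|[|r]] //= _ ->.
Qed.

Lemma entry_inj S i j i' j' : injective S -> entry S i j < sumn la ->
  entry S i j = entry S i' j' -> i = i' /\ j = j'.
Proof.
move=> injS lt eqS; have [c [_ ci cj Sc]] := entry_ltP erefl lt.
rewrite eqS in lt; have [d [_ di dj Sd]] := entry_ltP erefl lt.
have cd : c = d by apply/injS/ord_inj; rewrite Sc Sd.
by rewrite -ci -cj -di -dj cd.
Qed.

Lemma fresh_entry S M i j j0 j1 (k : 'I_(sumn la)) : injective S ->
    row_from S 0 j0 = tagged_row true M -> row_from S 1 j1 = tagged_row false M ->
    entry S i j = k -> (i == 0) ==> (j < j0) -> (i == 1) ==> (j < j1) ->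
  (k : nat) \notin values M.
Proof.
move=> injS row0 row1 Sk ij0 ij1; apply/mapP => -[[r x] xM /= kx].
have lt_k : entry S i j < sumn la by rewrite Sk.
have : x \in tagged_row r M by apply/mapP; exists (r, x); rewrite ?mem_filter ?eqxx.
rewrite -kx; case: r {xM}; rewrite -?row0 -?row1 => /mapP[j']; rewrite mem_iota -Sk
  => /andP[le_j' _] /(entry_inj injS lt_k)[ii jj].
  by move: ij0; rewrite ii jj /= ltnNge le_j'.
by move: ij1; rewrite ii jj /= ltnNge le_j'.
Qed.

Lemma size_row_from S i j : size (row_from S i j) = nth 0 la i - j.
Proof. by rewrite size_map size_iota. Qed.

Lemma count_tags r M : count (pred1 r) (tags M) = size (tagged_row r M).
Proof. by rewrite size_map size_filter count_map. Qed.

Lemma fuel_slide S M h j0 j1 t :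
    row_from S 0 j0 = tagged_row true M -> row_from S 1 j1 = tagged_row false M ->
  slide_cost h (tags M) t <= slide_fuel la.
Proof.
move=> row0 row1; apply: leq_trans (slide_cost_le _ _ _) _.
have -> : count id (tags M) = size (tagged_row true M).
  by rewrite -count_tags; apply: eq_count => -[].
have -> : downs (tags M) = size (tagged_row false M).
  by rewrite -count_tags; apply: eq_count => -[].
by rewrite -row0 -row1 !size_row_from /slide_fuel /=; lia.
Qed.

Definition run T (cs : seq (cell la)) (s : filling la * nat) : filling la * nat :=
  foldl (fun s c => slide (slide_fuel la) (T c) s) s cs.

(** Invariant: columns left of j are still initial, and M records the others. [acc] keeps the
    processing order, which is harmless because a rank depends only on the multiset. *)
Lemma run_word T j S M cnt (acc : seq nat) cs :
    injective S -> (forall i j', j' < j -> entry S i j' = entry T i j') ->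
    row_from S 0 j = tagged_row true M -> row_from S 1 j = tagged_row false M ->
    sorted ltn (values M) -> perm_eq acc (values M) ->
    [seq coord c | c <- cs] = cells_below j ->
  (run T cs (S, cnt)).2 = (foldl word_step (tags M, cnt)
     (zip (ops_below j) (ranks acc [seq (T c : nat) | c <- cs]))).2.
Proof.
elim: j S M cnt acc cs => [|j IH] S M cnt acc cs injS ST row0 row1 sM accM.
  by case: cs => // _; rewrite /ops_below /=.
(* The upper cell of column j is treated once for both column lengths; row 2 is already recorded
   from column j on. *)
have top S1 M1 cnt1 acc1 c cs1 : injective S1 ->
    (forall i j', j' < j -> entry S1 i j' = entry T i j') -> S1 c = T c ->
    row_from S1 0 j.+1 = tagged_row true M1 -> row_from S1 1 j = tagged_row false M1 ->
    sorted ltn (values M1) -> perm_eq acc1 (values M1) ->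
    coord c = (0, j) -> [seq coord c | c <- cs1] = cells_below j ->
  (run T (c :: cs1) (S1, cnt1)).2 = (foldl word_step (tags M1, cnt1)
     (zip (true :: ops_below j) (ranks acc1 [seq (T c : nat) | c <- c :: cs1]))).2.
  move=> injS1 S1T S1c row10 row11 sM1 accM1 [ci cj] cs1E.
  have Sk : entry S1 0 j = T c by rewrite -ci -cj entry_cell S1c.
  have row11' : row_from S1 1 j = drop 0 (tagged_row false M1) by rewrite drop0.
  have [S2 [sl injS2 row20 row21 eS2]] :=
    slide_row0 cnt1 injS1 Sk row10 row11' sM1 (fuel_slide 0 _ row10 row11).
  rewrite -[run _ _ _]/(run T cs1 (slide (slide_fuel la) (T c) (S1, cnt1))) sl.
  rewrite /= (perm_rank _ accM1) /word_step /= -tags_tag_slide //.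
  apply: IH => //.
  - by move=> i j' jj'; rewrite eS2 ?S1T.
  - by rewrite row21 drop0.
  - rewrite values_tag_slide sorted_insert //.
    by apply: (fresh_entry injS1 row10 row11 Sk) => /=.
  - rewrite values_tag_slide perm_sym; apply: perm_trans (perm_insert _ _) _.
    by rewrite perm_cons perm_sym.
have STj i j' : j' < j -> entry S i j' = entry T i j' by move=> jj'; rewrite ST // ltnW.
have STc c i : coord c = (i, j) -> S c = T c.
  by case=> ci cj; apply: ord_inj; rewrite -!entry_cell ci cj ST.
rewrite /ops_below /=; case: ltnP => jl2 /=; rewrite -/(ops_below j); last first.
  case: cs => // c cs [ci cj] csE; apply: top => //; first by apply: (STc _ 0); rewrite /coord ci cj.
    by rewrite -row1 !row_from_nil // leqW.
  by rewrite /coord ci cj.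
case: cs => [|d [|c cs]] // [di dj ci cj] csE.
have Sd : S d = T d by apply: (STc d 1); rewrite /coord di dj.
have Sk : entry S 1 j = T d by rewrite -di -dj entry_cell Sd.
have le_fuel : rank (T d) (tagged_row false M) <= slide_fuel la.
  by rewrite -row1 (leq_trans (count_size _ _)) // size_row_from /slide_fuel /=; lia.
have [S1 [sl injS1 row11 eS1]] :=
  slide_row1 cnt injS Sk row1 (sorted_tagged_row false sM) le_fuel.
have -> : run T (d :: c :: cs) (S, cnt) =
    run T (c :: cs) (S1, cnt + rank (T d) (tagged_row false M)) 
  by rewrite -sl.
rewrite (top _ (tag_insert M (T d)) _ ((T d : nat) :: acc)) //.
- rewrite /= (perm_rank (T d) accM) /word_step /=.
  by rewrite tags_tag_insert // downs_before_rank.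
- by move=> i j' jj'; rewrite eS1 ?STj // [j <= j']leqNgt jj' andbF.
- apply: ord_inj; rewrite -[LHS]entry_cell ci cj eS1 // -ci -cj entry_cell.
  by rewrite (STc c 0) // /coord ci cj.
- rewrite tagged_row_insert_true -row0; apply: eq_row_from => j' _.
  by rewrite eS1.
- by rewrite row11 tagged_row_insert.
- rewrite values_tag_insert sorted_insert //.
  by apply: (fresh_entry injS row0 row1 Sk) => /=.
- rewrite values_tag_insert perm_sym; apply: perm_trans (perm_insert _ _) _.
  by rewrite perm_cons perm_sym.
- by rewrite /coord ci cj.
Qed.

Definition order_ranks T : seq nat := ranks [::] [seq (T c : nat) | c <- nps_order la].

Lemma nexchanges_word T : injective T ->
  nexchanges T =
  (foldl word_step ([::], 0) (zip (shape_ops (l1 - l2) l2) (order_ranks T))).2.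
Proof.
move=> injT; rewrite -ops_belowE subnK //.
apply: (@run_word T l1 T [::] 0 [::]) => //; last exact: coord_nps_order.
- by rewrite row_from_nil.
- by rewrite row_from_nil.
Qed.

Lemma size_nps_order : size (nps_order la) = sumn la.
Proof.
rewrite -(size_map coord) coord_nps_order -(size_map (fun p => p.1 == 0)).
rewrite -/(ops_below l1) -[in ops_below _](subnK l21) ops_belowE size_shape_ops /=.
lia.
Qed.

Lemma card_cell : #|cell la| = sumn la.
Proof. by rewrite -size_nps_order size_rev size_sort cardE. Qed.

Lemma mem_nps_order c : c \in nps_order la.
Proof. by rewrite mem_rev mem_sort mem_enum. Qed.

Lemma tableauxE : tableaux la = [set T : filling la | injectiveb T].
Proof.
apply/setP => T; rewrite !inE andb_idr // => /injectiveP injT.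
apply/forallP => k; apply/existsP.
have [|g _ gK] := @inj_card_bij _ _ T injT; first by rewrite card_ord card_cell.
by exists (g k); rewrite gK.
Qed.

Lemma perm_entries T : injective T ->
  perm_eq [seq (T c : nat) | c <- nps_order la] (iota 0 (sumn la)).
Proof.
move=> injT; have uT : uniq [seq (T c : nat) | c <- nps_order la].
  rewrite map_inj_uniq ?rev_uniq ?sort_uniq ?enum_uniq //.
  by move=> c d /ord_inj/injT.
apply: uniq_perm (iota_uniq _ _) _ => //.
have [||//] := uniq_min_size (s2 := iota 0 (sumn la)) uT.
  by move=> _ /mapP[c _ ->]; rewrite mem_iota add0n ltn_ord.
by rewrite size_iota size_map size_nps_order.
Qed.

(** The map is injective by [ranks_inj], and both lists have [(sumn la)!] elements. *)
Lemma perm_order_ranks :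
  perm_eq [seq order_ranks T | T <- enum (tableaux la)] (codes 0 (sumn la)).
Proof.
have uT : uniq [seq order_ranks T | T <- enum (tableaux la)].
  rewrite map_inj_in_uniq ?enum_uniq // => T T'.
  rewrite !mem_enum tableauxE !inE => /injectiveP injT /injectiveP injT'.
  case/ranks_inj; rewrite ?size_map //.
    by rewrite (perm_trans (perm_entries injT)) // perm_sym perm_entries.
  move/eq_in_map => eqT _; apply/ffunP => c; apply: ord_inj.
  by apply: eqT; rewrite mem_nps_order.
apply: uniq_perm (codes_uniq _ _) _ => //.
have [||//] := uniq_min_size (s2 := codes 0 (sumn la)) uT.
  move=> _ /mapP[T _ ->]; have := ranks_codes [::] [seq (T c : nat) | c <- nps_order la].
  by rewrite size_map size_nps_order.
have -> : size (codes 0 (sumn la)) = (sumn la)`!.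
  by rewrite -(size_codes 0 (sumn la)) muln1.
by rewrite size_map -cardE tableauxE card_inj_ffuns card_ord card_cell ffactnn.
Qed.

Lemma sum_nexchanges :
  (\sum_(T in tableaux la) (nexchanges T)%:R : rat)%R =
  code_sum (shape_ops (l1 - l2) l2) ([::], 0) (fun s => s.2%:R%R).
Proof.
rewrite -codes_sum size_shape_ops.
have -> : l1 - l2 + 2 * l2 = sumn la by rewrite /=; lia.
rewrite -(perm_big _ perm_order_ranks) big_map big_enum /=.
apply: eq_bigr => T; rewrite tableauxE inE => /injectiveP injT.
by rewrite nexchanges_word.
Qed.

End TwoRowRuns.

Theorem theorem6p1 (l1 l2 : nat) (hl2 : (1 <= l2)%N) (hl12 : (l2 <= l1)%N) :
  nps_complexity [:: l1; l2] =
    (l1%:R * (l1%:R - 1) / 4 + l2%:R * (l2%:R - 3) / 4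
     - 2 * \sum_(1 <= k < l2.+1)
             'C(l2, k)%:R
             * ((-1) ^+ k * ((2 * k - 2)`!)%:R
                / poch (l1%:R - l2%:R + 2) (2 * k - 1)))%R.
Proof.
rewrite /nps_complexity sum_nexchanges // code_sum_cost -/(two_row_formula l1 l2).
have -> : sumn [:: l1; l2] = l1 - l2 + 2 * l2 by rewrite /=; lia.
by rewrite subnK // mulrC mulKf // natf_fact_neq0.
Qed.
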